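(* Let $G$ be a twin-free, connected proper circular-arc graph. (1) If $\overline{G}$ is non-bipartite, then $\mathcal{N}[G]$ has, up to reversal, a unique arc ordering. (2) If $\overline{G}$ is bipartite and connected, then $\mathcal{N}[G]$ has, up to reversal, exactly two tight arc orderings.
   Context: Vertices $u\ne v$ of $G$ are twins if $N[u]=N[v]$ (closed neighborhoods); $G$ is twin-free if it has none. $\mathcal{N}[G]$ is the hypergraph on $V=V(G)$ with hyperedges $N[v]$, $v\in V$. A PCA graph is one having a representation by arcs of a circle, adjacency meaning intersection, in which no arc is contained in another. An arc ordering of a hypergraph on $V$ is a circular ordering of $V$ in which every hyperedge is a set of circularly consecutive vertices (an arc); it is tight if for any hyperedges $A,B$ with $\emptyset\neq A\subseteq B\neq V$ the arcs $A,B$ share an endpoint. Up to reversal means up to reversing the circular order.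
   Formalization: ''Bipartite'' is taken to mean a partition into two nonempty independent classes, so the one-vertex graph does not count as bipartite; it falls under (1) rather than (2), where the claim of exactly two tight arc orderings would be false for it. *)

(* Defs.v *)
From mathcomp Require Import all_boot all_order all_algebra all_fingroup.
From mathcomp Require Import reals.

Set Implicit Arguments.
Unset Strict Implicit.
Unset Printing Implicit Defensive.

Import Order.TTheory GRing.Theory Num.Theory.

(* A finite simple graph is a symmetric irreflexive relation on a finType. *)
Section Graphs.
Variables (T : finType) (e : rel T).

Definition closed_nbhd (v : T) : {set T} := [set u | (u == v) || e v u].

Definition twin_free : Prop :=
  forall u v : T, u != v -> closed_nbhd u <> closed_nbhd v.

Definition graph_connected : Prop :=
  (0 < #|T|)%N /\ forall u v : T, connect e u v.

Definition complement : rel T := [rel u v | (u != v) && ~~ e u v].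

(* The vertex set has a partition into two independent classes.  As usual for
   partitions, both classes are nonempty; on at least two vertices this is
   2-colourability, while the one-vertex graph does not count as bipartite. *)
Definition bipartite : Prop :=
  exists P : {set {set T}},
    [/\ partition P [set: T], #|P| = 2
      & forall A u v, A \in P -> u \in A -> v \in A -> ~~ e u v].

Definition nbhd_hypergraph : {set {set T}} := [set closed_nbhd v | v : T].

End Graphs.

Section ProperCircularArc.
Local Open Scope ring_scope.
Variable R : realType.

(* The circle is R/Z, its points being represented in [0, 1[. *)
Definition circle_point (x : R) : bool := (0 <= x) && (x < 1).

(* The closed arc traversed from a to b in the direction of increasing
   coordinates; it passes through 0 when b < a. *)
Definition in_circle_arc (a b x : R) : bool :=
  circle_point x &&
  (if a <= b then (a <= x) && (x <= b) else (a <= x) || (x <= b)).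

Definition proper_circular_arc (T : finType) (e : rel T) : Prop :=
  exists l r : T -> R,
    [/\ forall v, circle_point (l v) && circle_point (r v),
        forall u v, u != v ->
          (e u v <->
           exists x, in_circle_arc (l u) (r u) x && in_circle_arc (l v) (r v) x)
      & forall u v, u != v ->
          ~ (forall x, in_circle_arc (l u) (r u) x ->
                       in_circle_arc (l v) (r v) x)].

End ProperCircularArc.

Section CircularOrders.
Variable T : finType.
Implicit Types (s : {perm T}) (A B : {set T}) (H : {set {set T}}).

(* A circular ordering is given by its successor map, a permutation consisting
   of a single cycle; the reversed ordering is then the inverse permutation. *)
Definition circular_order s : Prop := forall x : T, porbit s x = [set: T].

(* The vertices met when moving from a to b along s; [findex s a x] is the
   number of steps from a to x. *)
Definition arc_between s (a b : T) : {set T} :=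
  [set x | (findex s a x <= findex s a b)%N].

Definition is_arc s A : Prop :=
  A = set0 \/ exists a b : T, A = arc_between s a b.

Definition arc_ordering H s : Prop :=
  circular_order s /\ forall A, A \in H -> is_arc s A.

(* Endpoints of a nonempty arc other than the whole of T are unique, so it does
   not matter that they are quantified existentially here. *)
Definition share_endpoint s A B : Prop :=
  exists a b c d : T,
    [/\ A = arc_between s a b, B = arc_between s c d
      & [set a; b] :&: [set c; d] != set0].

Definition tight_arc_ordering H s : Prop :=
  arc_ordering H s /\
  forall A B, A \in H -> B \in H ->
    A != set0 -> A \subset B -> B != [set: T] -> share_endpoint s A B.

Definition same_up_to_reversal (s t : {perm T}) : Prop :=
  s = t \/ s = (t^-1)%g.

Definition unique_up_to_reversal (Q : {perm T} -> Prop) : Prop :=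
  exists s, Q s /\ forall t, Q t -> same_up_to_reversal t s.

Definition exactly_two_up_to_reversal (Q : {perm T} -> Prop) : Prop :=
  exists s1 s2,
    [/\ Q s1, Q s2, ~ same_up_to_reversal s1 s2
      & forall t, Q t -> same_up_to_reversal t s1 \/ same_up_to_reversal t s2].

End CircularOrders.

(* Main.v *)
Require Import Defs.
From mathcomp Require Import all_boot all_order all_algebra all_fingroup.
From mathcomp Require Import reals.
From mathcomp Require Import zify lra.

Set Implicit Arguments.
Unset Strict Implicit.
Unset Printing Implicit Defensive.

Import Order.TTheory GRing.Theory Num.Theory.

(* Call a set an arc of a circular order [s] when [s] leaves it at most once.
   The number of exits is submodular and invariant under complement, so arcs
   shared by two orders are closed under the intersections, unions and
   differences of crossing arcs.  If every nontrivial arc of [s], except possibly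
   [X] and its complement, is crossed by an arc shared with [t], then [t] or its
   reversal agrees with [s] on [X]: an agreeing path grows one vertex at a time
   inside a minimal shared arc crossing it.

   Sorting the arcs of a proper model by left endpoint gives an order [s] in
   which every closed neighborhood is an arc, and which is tight.  If the
   complement is not bipartite, consecutive vertices have a common non-neighbor;
   following the non-neighborhoods around the circle, an arc crossed by no
   neighborhood would force twins or a disconnected graph.  If the complement is
   connected bipartite with sides [X] and [Y], both sides are arcs of every tight
   order, and an arc inside a side is crossed by some co-neighborhood or by a
   difference of two nested ones, which is an arc by tightness.  So a tight order
   is determined up to reversal on each side, and only the relative orientation
   of the two sides is free. *)

(** * Exit counts of vertex sets, and crossing sets *)

Section Exits.
Variable T : finType.
Implicit Types (s t : {perm T}) (A B X I : {set T}) (x y z : T).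

Definition exits s A : {set T} := [set x in A | s x \notin A].

(** At most one exit, rather than exactly one, lets the empty set and the whole of [T] count as
    arcs. *)
Definition arcb s A : bool := #|exits s A| <= 1.

(** All four cells of the Venn diagram are nonempty, so the relation survives complementing either
    set. *)
Definition crosses A B : bool :=
  [&& A :&: B != set0, A :\: B != set0, B :\: A != set0 & A :|: B != setT].

Lemma exitsE s A x : (x \in exits s A) = (x \in A) && (s x \notin A).
Proof. by rewrite inE. Qed.

Lemma circular_closed s A x : circular_order s ->
  (forall y, y \in A -> s y \in A) -> x \in A -> A = setT.
Proof.
move=> cs cA xA; apply/setP => y; rewrite inE.
have /porbitP[i ->] : y \in porbit s x by rewrite cs inE.
by elim: i => [|i IH]; rewrite ?expg0 ?perm1 // expgSr permM; apply: cA.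
Qed.

Lemma closed_circular s :
  (forall A x, (forall y, y \in A -> s y \in A) -> x \in A -> A = setT) ->
  circular_order s.
Proof.
move=> h x; apply: (h _ x); last exact: porbit_id.
by move=> y /porbitP[i ->]; rewrite -permM -expgSr mem_porbit.
Qed.

Lemma circularV s : circular_order s -> circular_order s^-1%g.
Proof. by move=> cs x; rewrite porbitV cs. Qed.

Lemma exit_ex s A x y : circular_order s -> x \in A -> y \notin A ->
  exists2 z, z \in A & s z \notin A.
Proof.
move=> cs xA yA; have [z|h] := pickP (mem (exits s A)).
  by rewrite /= inE => /andP[]; exists z.
move: yA; rewrite (circular_closed cs _ xA) ?inE // => z zA.
by apply: contraFT (h z) => nz; rewrite /= inE zA.
Qed.

Lemma entry_ex s A x y : circular_order s -> x \in A -> y \notin A ->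
  exists2 z, z \notin A & s z \in A.
Proof.
move=> cs xA yA; have [||z] := @exit_ex s (~: A) y x cs; rewrite ?inE ?negbK //.
by exists z.
Qed.

(** Exits of the complement are the entries of [A]. Since [A] and its preimage under [s] have the
    same size, so do their two differences. *)
Lemma card_exitsC s A : #|exits s (~: A)| = #|exits s A|.
Proof.
have -> : exits s (~: A) = (s @^-1: A) :\: A by apply/setP => x; rewrite !inE negbK.
have -> : exits s A = A :\: (s @^-1: A) by apply/setP => x; rewrite !inE andbC.
by rewrite !cardsD setIC card_preimset //; apply: perm_inj.
Qed.

Lemma arcbC s A : arcb s (~: A) = arcb s A.
Proof. by rewrite /arcb card_exitsC. Qed.

Lemma arcbV s A : arcb s^-1%g A = arcb s A.
Proof.
rewrite -[RHS]arcbC /arcb -[in RHS](card_imset _ (@perm_inj _ s)).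
congr (#|pred_of_set _| <= 1).
apply/setP => x; rewrite inE; apply/andP/imsetP => [[xA h]|[y]].
  by exists ((s^-1)%g x); rewrite ?permKV // !inE permKV negbK h.
by rewrite !inE negbK => /andP[yA syA] ->; rewrite permK.
Qed.

Lemma card_exitsUI s A B :
  #|exits s (A :|: B)| + #|exits s (A :&: B)| <= #|exits s A| + #|exits s B|.
Proof.
(* Inclusion-exclusion on both sides leaves two inclusions, between the unions and between the
   intersections of the exit sets. *)
rewrite -[leqLHS]cardsUI -[leqRHS]cardsUI.
by apply: leq_add; apply: subset_leq_card; apply/subsetP => x; rewrite !inE;
  do !case: (_ \in _).
Qed.

Lemma exits_gt0 s A x y : circular_order s -> x \in A -> y \notin A ->
  0 < #|exits s A|.
Proof.
move=> cs xA yA; have [z zA szA] := exit_ex cs xA yA.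
by apply/card_gt0P; exists z; rewrite exitsE zA.
Qed.

Lemma arcb1 s x : arcb s [set x].
Proof.
apply: leq_trans (_ : #|[set x]| <= 1); last by rewrite cards1.
by apply: subset_leq_card; apply/subsetP => y; rewrite exitsE => /andP[].
Qed.

Lemma arcb_exits s A b : (forall x, x \in A -> s x \notin A -> x = b) -> arcb s A.
Proof.
move=> h; rewrite /arcb -(cards1 b); apply: subset_leq_card.
by apply/subsetP => x; rewrite exitsE inE => /andP[xA sx]; apply/eqP/h.
Qed.

Lemma arcb_uniq s A :
  (forall x y, x \in A -> s x \notin A -> y \in A -> s y \notin A -> x = y) ->
  arcb s A.
Proof.
move=> h; apply/card_le1_eqP => x y; rewrite !exitsE => /andP[? ?] /andP[? ?].
exact: h.
Qed.

Lemma arc_exit_uniq s A x y : arcb s A ->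
  x \in A -> s x \notin A -> y \in A -> s y \notin A -> x = y.
Proof.
move=> /card_le1_eqP h xA sxA yA syA.
by apply: h; rewrite exitsE ?xA ?yA ?sxA ?syA.
Qed.

Lemma arc_entry_uniq s A x y : arcb s A ->
  x \notin A -> s x \in A -> y \notin A -> s y \in A -> x = y.
Proof.
rewrite -arcbC => aA xA sxA yA syA.
by apply: (arc_exit_uniq aA); rewrite ?inE ?negbK.
Qed.

(** The witnesses [x] and [y] force at least one exit from the union and one from the intersection,
    and by submodularity the two counts add up to at most two. *)
Lemma arcbUI s A B x y : circular_order s -> arcb s A -> arcb s B ->
  x \in A :&: B -> y \notin A :|: B -> arcb s (A :|: B) /\ arcb s (A :&: B).
Proof.
move=> cs aA aB xI yU.
have xU : x \in A :|: B by move: xI; rewrite !inE => /andP[->].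
have yI : y \notin A :&: B by apply: contra yU; rewrite !inE => /andP[->].
have := card_exitsUI s A B; move: (exits_gt0 cs xI yI) (exits_gt0 cs xU yU).
by move: aA aB; rewrite /arcb; lia.
Qed.

(** If neither set contained the other, [A :&: B] would be entered once from [A :\: B] and once from
    [B :\: A], although it is an arc. *)
Lemma arc_nested s A B b : circular_order s -> arcb s A -> arcb s B ->
  b \in A -> s b \notin A -> b \in B -> s b \notin B ->
  (A \subset B) || (B \subset A).
Proof.
move=> cs aA aB bA sbA bB sbB; apply/norP => -[].
case/subsetPn => x xA xB; case/subsetPn => y yB yA.
have aI : arcb s (A :&: B).
  by case: (@arcbUI s A B b (s b)); rewrite // !inE ?bA ?bB // negb_or sbA.
have key (C D : {set T}) z : arcb s C -> b \in C -> b \in D -> s b \notin C -> z \in C ->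
    z \notin D -> exists u, [/\ u \in C, u \notin D & s u \in C :&: D].
  move=> aC bC bD sbC zC zD.
  have [||u] := @exit_ex s (C :\: D) z b cs; rewrite ?inE ?zC ?zD ?bD //.
  case/andP=> uD uC sun; exists u; split=> //; rewrite inE; move: sun.
  have [suC|suC _] := boolP (s u \in C); first by rewrite andbT negbK => ->.
  by move: uD; rewrite -(arc_exit_uniq aC bC sbC uC suC) bD.
have [u [uA uB su]] := key A B x aA bA bB sbA xA xB.
have [v [vB vA sv]] := key B A y aB bB bA sbB yB yA.
have uv : u = v.
  apply: (arc_entry_uniq aI); rewrite ?su ?inE ?(negPf uB) ?(negPf vA) ?andbF //.
  by move: sv; rewrite inE andbC.
by move: uB; rewrite uv vB.
Qed.

Lemma circular_fix s x y : circular_order s -> x != y -> s x != x.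
Proof.
move=> cs xy; apply/negP => /eqP h.
have : [set x] = setT.
  by apply: (@circular_closed s _ x cs); rewrite ?inE // => z; rewrite !inE => /eqP->; rewrite h.
by move/setP/(_ y); rewrite !inE eq_sym (negPf xy).
Qed.

Lemma crossesCl A B : crosses (~: A) B = crosses A B.
Proof.
rewrite /crosses [~: A :&: B]setIC -setDE [B :\: ~: A]setDE setCK [B :&: A]setIC.
have -> : (~: A :\: B != set0) = (A :|: B != setT).
  by rewrite setDE -setCU -(inj_eq (@setC_inj _)) setCK setC0.
have -> : (~: A :|: B != setT) = (A :\: B != set0).
  by rewrite -(inj_eq (@setC_inj _)) setCU setCK setCT -setDE.
by do !case: (_ != _).
Qed.

Lemma crossesC A B : crosses A B = crosses B A.
Proof.
rewrite /crosses setIC setUC; by do !case: (_ != _).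
Qed.

Lemma crossesCr A B : crosses A (~: B) = crosses A B.
Proof. by rewrite crossesC crossesCl crossesC. Qed.

Lemma crossesP A B x y z u : x \in A -> x \in B -> y \in A -> y \notin B ->
  z \notin A -> z \in B -> u \notin A -> u \notin B -> crosses A B.
Proof.
move=> xA xB yA yB zA zB uA uB; apply/and4P; split.
- by apply/set0Pn; exists x; rewrite inE xA.
- by apply/set0Pn; exists y; rewrite inE yA yB.
- by apply/set0Pn; exists z; rewrite inE zA zB.
- by apply: contraNneq uA => /setP/(_ u); rewrite !inE (negPf uB) orbF => ->.
Qed.

Lemma crosses_ex A B : crosses A B -> exists x y z u,
  [/\ [/\ x \in A & x \in B], [/\ y \in A & y \notin B],
      [/\ z \notin A & z \in B] & [/\ u \notin A & u \notin B]].
Proof.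
case/and4P => /set0Pn[x] + /set0Pn[y] + /set0Pn[z] + h.
have /set0Pn[u] : ~: (A :|: B) != set0 by rewrite -(inj_eq (@setC_inj _)) setCK setC0.
rewrite !inE negb_or => /andP[? ?] /andP[? ?] /andP[? ?] /andP[? ?].
by exists x, y, z, u.
Qed.

End Exits.

(** * Circular orders sharing enough arcs agree up to reversal *)

Section Agreement.
Variable T : finType.
Implicit Types (s t : {perm T}) (A B D X I : {set T}) (x y z : T).

Definition agree s t I := forall x, x \in I -> s x \in I -> t x = s x.

Definition common_arc s t A := arcb s A && arcb t A.

Lemma common_arcC s t A : common_arc s t (~: A) = common_arc s t A.
Proof. by rewrite /common_arc !arcbC. Qed.

Lemma common_arcUI s t A B x y : circular_order s -> circular_order t ->
  common_arc s t A -> common_arc s t B ->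
  x \in A :&: B -> y \notin A :|: B ->
  common_arc s t (A :|: B) /\ common_arc s t (A :&: B).
Proof.
move=> cs ct /andP[sA tA] /andP[sB tB] xI yU; rewrite /common_arc.
have [-> ->] := arcbUI cs sA sB xI yU.
by have [-> ->] := arcbUI ct tA tB xI yU.
Qed.

Lemma crosses_commonID s t A B : circular_order s -> circular_order t ->
  common_arc s t A -> common_arc s t B -> crosses A B ->
  common_arc s t (A :&: B) /\ common_arc s t (A :\: B).
Proof.
move=> cs ct cA cB /crosses_ex[x [y [z [u [[xA xB] [yA yB] [zA zB] [uA uB]]]]]].
split; first by case: (@common_arcUI s t A B x u); rewrite // !inE ?xA // negb_or uA.
rewrite setDE; case: (@common_arcUI s t A (~: B) y z) => //.
- by rewrite common_arcC.
- by rewrite !inE yA.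
- by rewrite !inE negb_or zA negbK.
Qed.

Lemma agree_arc s t I : arcb s I -> agree s t I -> arcb t I.
Proof.
move=> aI ag; apply: leq_trans aI; apply: subset_leq_card; apply/subsetP => x.
rewrite !exitsE => /andP[xI txI]; rewrite xI /=; apply: contra txI => sxI.
by rewrite ag.
Qed.

Lemma agreeV s t I : agree s t I -> agree s^-1%g t^-1%g I.
Proof.
move=> ag x xI sxI; apply: (@perm_inj _ t); rewrite permKV.
by rewrite ag ?permKV.
Qed.

Lemma crosses_exit_next s A I b : circular_order s -> arcb s A -> arcb s I ->
  crosses A I -> b \in I -> s b \notin I -> b \in A -> s b \in A.
Proof.
move=> cs aA aI cAI bI sbI bA; apply: contraLR cAI => sbA.
have := arc_nested cs aA aI bA sbA bI sbI; rewrite /crosses -!setD_eq0.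
by case/orP => /eqP ->; rewrite eqxx ?andbF.
Qed.

(* Among the common arcs through [b] and [s b] crossing [I], a minimal one is
   [A :&: I] followed by the single vertex [s b]: otherwise [A :\: I] is itself
   crossed by a common arc, which cuts [A] down. *)
Lemma agree_exit s t I b A : circular_order s -> circular_order t ->
  arcb s I -> 1 < #|I| -> agree s t I -> b \in I -> s b \notin I ->
  (forall D, arcb s D -> 1 < #|D| -> D \subset ~: I -> s b \in D ->
     exists2 B, common_arc s t B & crosses B D) ->
  common_arc s t A -> crosses A I -> b \in A -> s b \in A -> t b = s b.
Proof.
move=> cs ct aI I2 ag bI sbI HD.
have cI : common_arc s t I by rewrite /common_arc aI (agree_arc aI ag).
have [m] := ubnP #|A|; elim: m A => // m IH A Am cA cAI bA sbA.
have [x [y [w [u [[xA xI] [yA yI] [wA wI] [uA uI]]]]]] := crosses_ex cAI.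
have [cAnI cD] := crosses_commonID cs ct cA cI cAI.
(* [A] is entered at [p] inside [I], so the entry [z] of [A :|: I] can only lead into [I] and not
   into [A]. *)
have [z [zI szI szA]] : exists z, [/\ z \notin I, s z \in I & s z \notin A].
  have [||p] := @exit_ex _ s (I :\: A) w b cs; rewrite ?inE ?wI ?wA ?bA //.
  case/andP=> pA pI spn.
  have spI : s p \in I.
    apply: contraNT pA => spI.
    by rewrite (arc_exit_uniq aI pI spI bI sbI).
  have spA : s p \in A by move: spn; rewrite spI andbT negbK.
  have [||z] := @exit_ex _ s (~: (A :|: I)) u b cs.
  - by rewrite !inE negb_or uA.
  - by rewrite !inE bA.
  rewrite !inE negbK negb_or => /andP[zA zI] szn.
  have szA : s z \notin A.
    apply/negP => szA; have/andP[aA _] := cA.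
    by move: zI; rewrite (arc_entry_uniq aA zA szA pA spA) pI.
  by exists z; split=> //; move: szn; rewrite (negPf szA).
have [D2|D1] := ltnP 1 #|A :\: I|.
  have [] := HD (A :\: I); rewrite ?inE ?sbI //; first by case/andP: cD.
    by apply/subsetP => v; rewrite !inE => /andP[].
  move=> B0 cB0 cBD0.
  have [B [cB cBD bB]] : exists B, [/\ common_arc s t B, crosses B (A :\: I) & b \in B].
    have [bB|bB] := boolP (b \in B0); first by exists B0.
    by exists (~: B0); rewrite common_arcC crossesCl inE.
  have /andP[aB _] := cB; have /andP[aD _] := cD.
  have sbB : s b \in B.
    apply: (@crosses_exit_next s B (~: (A :\: I)) b) => //; rewrite ?arcbC ?crossesCr //.
      by rewrite !inE bI.
    by rewrite !inE sbI sbA.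
  have [x1 [x2 [x3 [x4 [[x1B x1D] [x2B x2D] [x3B x3D] [x4B x4D]]]]]] := crosses_ex cBD.
  (* If [A] and [B] covered everything, the complement of [B] would be left both at [e1] in [I] and
     at [e2] outside [I]. *)
  have [q qA qB] : exists2 q, q \notin A & q \notin B.
    case: (pickP [pred q | (q \notin A) && (q \notin B)]) => [q /andP[]|h]; first by exists q.
    have BA v : v \notin B -> v \in A.
      by move=> vB; have := h v; rewrite /= vB andbT => /negbFE.
    have x4I : x4 \in I by move: x4D; rewrite inE (BA _ x4B) andbT negbK.
    have [||e1] := @exit_ex _ s (~: B :&: I) x4 b cs; rewrite ?inE ?x4B ?bB //.
    case/andP=> e1B e1I; rewrite negb_and negbK => se1.
    have {}se1 : s e1 \in B.
      case/orP: se1 => // se1I; move: e1B.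
      by rewrite (arc_exit_uniq aI e1I se1I bI sbI) bB.
    have [||e2] := @exit_ex _ s (~: B :&: (A :\: I)) x3 b cs.
    - by rewrite inE x3D inE x3B.
    - by rewrite !inE bB.
    rewrite !inE => /andP[e2B /andP[e2I e2A]] se2.
    have {}se2 : s e2 \in B.
      apply: contraNT szA => se2B; move: se2; rewrite se2B (BA _ se2B) andbT /= negbK => se2I.
      by rewrite (arc_entry_uniq aI zI szI e2I se2I) BA.
    move: e2I; rewrite -(@arc_exit_uniq _ s (~: B) e1 e2) ?arcbC ?inE ?e1I ?negbK //.
  have [||_ cAB] := @common_arcUI s t A B b q cs ct cA cB.
  - by rewrite inE bA.
  - by rewrite inE negb_or qA.
  apply: (IH (A :&: B)) => //.
  - rewrite -ltnS; apply: leq_trans Am; rewrite ltnS; apply: proper_card; rewrite properE subsetIl /=.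
    by apply/subsetPn; exists x3; move: x3D; rewrite !inE ?(negPf x3B) ?andbF // => /andP[].
  - apply: (@crossesP _ _ _ b (s b) w u); rewrite ?inE ?bA ?sbA ?(negPf wA) ?(negPf uA) //.
  - by rewrite inE bA.
  - by rewrite inE sbA.
have AI v : v \in A -> v != s b -> v \in I.
  move=> vA vb; apply: contraNT vb => vI; apply/eqP.
  by move/card_le1_eqP: D1; apply; rewrite inE ?vI ?sbI.
have /andP[aA taA] := cA; have /andP[aAI _] := cAnI.
have tbAI : t b \notin A :&: I.
  apply/negP => h; have : A :&: I = setT.
    apply: (@circular_closed _ t _ b ct); last by rewrite inE bA.
    move=> v vAI; have [->//|vb] := eqVneq v b.
    have svAI : s v \in A :&: I.
      apply: contraNT vb => svAI; apply/eqP.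
      by apply: (arc_exit_uniq aAI vAI svAI); rewrite inE ?bA // (negPf sbI) andbF.
    by move: vAI svAI; rewrite !inE => /andP[vA vI] /andP[svA svI]; rewrite ag // svA.
  by move/setP/(_ u); rewrite !inE (negPf uA).
(* Otherwise [b] is the exit of [A] under [t], so [t (s b)] stays in [A] and hence in [I]. Its
   predecessor [p] under [s] is either in [I], where agreement gives [p = s b], or equal to [z],
   whose successor avoids [A]; both are absurd. *)
apply/eqP; apply: contraT => tb.
have tbA : t b \notin A by apply: contra tbAI => tbA; rewrite inE tbA AI.
have bsb : b != s b by apply: contraNneq sbI => <-.
have tsbA : t (s b) \in A.
  apply: contraNT bsb => h.
  exact/eqP/(arc_exit_uniq taA bA tbA sbA h).
have tsb : t (s b) != s b by apply: (circular_fix ct (y := b)); rewrite eq_sym.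
have yI' := AI _ tsbA tsb.
pose p := (s^-1)%g (t (s b)).
have sp : s p = t (s b) by rewrite permKV.
have [pI|pI] := boolP (p \in I).
  have : t p = s p by apply: ag; rewrite // sp.
  by rewrite sp => /perm_inj pe; move: sbI; rewrite -pe pI.
by move: szA; rewrite (arc_entry_uniq aI zI szI pI) sp ?tsbA.
Qed.

Lemma card_gt1_ne I b : 1 < #|I| -> exists2 x, x \in I & x != b.
Proof.
move=> I2; case: (pickP [pred x | (x \in I) && (x != b)]) => [x /andP[]|h]; first by exists x.
move: I2; rewrite ltnNge -(cards1 b) subset_leq_card //.
by apply/subsetP => x xI; rewrite inE; have := h x; rewrite /= xI => /negbFE.
Qed.

(** A common arc crossing [I], or its complement, contains [b] and then [s b], so [agree_exit]
    applies. No other step becomes internal: a step from [s b] back into [I] would close the circle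
    inside [X]. *)
Lemma agree_grow s t X I b : circular_order s -> circular_order t ->
  X != setT ->
  (forall D, arcb s D -> 1 < #|D| -> 1 < #|~: D| -> D != X -> D != ~: X ->
     exists2 B, common_arc s t B & crosses B D) ->
  arcb s I -> 1 < #|I| -> I \subset X -> agree s t I ->
  b \in I -> s b \notin I -> s b \in X ->
  arcb s (s b |: I) /\ agree s t (s b |: I).
Proof.
move=> cs ct XT H aI I2 IX ag bI sbI sbX.
have /subsetPn[u _ uX] : ~~ (setT \subset X) by rewrite subTset.
have uI : u \notin I by apply: contra uX => /(subsetP IX).
have CI2 : 1 < #|~: I|.
  have : [set s b; u] \subset ~: I.
    by apply/subsetP => v /set2P[]->; rewrite inE.
  move/subset_leq_card; rewrite cards2.
  by rewrite (_ : s b != u) //; apply: contraNneq uX => <-.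
have ext : arcb s (s b |: I).
  apply: (@arcb_exits _ _ _ (s b)) => x; rewrite !inE => /orP[/eqP //|xI].
  rewrite negb_or => /andP[sx sxI]; move: sx.
  by rewrite (arc_exit_uniq aI xI sxI bI sbI) eqxx.
split=> //.
have [A0 cA0 cAI0] : exists2 B, common_arc s t B & crosses B I.
  apply: H => //; first by apply: contraNneq sbI => ->.
  by apply/eqP => IE; move: (bI); rewrite IE inE (subsetP IX).
have [A [cA cAI bA]] : exists A, [/\ common_arc s t A, crosses A I & b \in A].
  have [bB|bB] := boolP (b \in A0); first by exists A0.
  by exists (~: A0); rewrite common_arcC crossesCl inE.
have sbA : s b \in A.
  by case/andP: (cA) => aA _; apply: (crosses_exit_next cs aA aI cAI).
have tb : t b = s b.
  apply: (@agree_exit s t I b A) => // D aD D2 DI sbD; apply: H => //.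
  - apply: leq_trans I2 _; apply: subset_leq_card; apply/subsetP => v vI.
    by rewrite inE; apply/negP => /(subsetP DI); rewrite inE vI.
  - apply/eqP => DX.
    have /(subsetP DI) : b \in D by rewrite DX (subsetP IX).
    by rewrite inE bI.
  - by apply: contraTneq sbD => ->; rewrite inE sbX.
move=> x; rewrite !inE => /orP[/eqP->|xI].
  rewrite (negPf (circular_fix cs (_ : _ != u))) /=; last by apply: contraNneq uX => <-.
  move=> ssb; have : s b |: I = setT.
    apply: (@circular_closed _ s _ b cs); last by rewrite !inE bI orbT.
    move=> v; rewrite !inE => /orP[/eqP->|vI]; first by rewrite ssb orbT.
    have [svI|svI] := boolP (s v \in I); first by rewrite orbT.
    by rewrite (arc_exit_uniq aI vI svI bI sbI) eqxx.
  by move/setP/(_ u); rewrite !inE (negPf uI) orbF => /eqP usb; move: uX; rewrite usb sbX.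
have [svI|svI _] := boolP (s x \in I); first by rewrite ag.
by rewrite (arc_exit_uniq aI xI svI bI sbI).
Qed.

Lemma agree_spread s t X I : circular_order s -> circular_order t ->
  X != setT -> arcb s X ->
  (forall D, arcb s D -> 1 < #|D| -> 1 < #|~: D| -> D != X -> D != ~: X ->
     exists2 B, common_arc s t B & crosses B D) ->
  arcb s I -> 1 < #|I| -> I \subset X -> agree s t I -> agree s t X.
Proof.
move=> cs ct XT aX H; have [m] := ubnP (#|X| - #|I|).
elim: m I => // m IH I Im aI I2 IX ag.
have [<-//|neIX] := eqVneq I X.
have /subsetPn[u _ uX] : ~~ (setT \subset X) by rewrite subTset.
have [w wX wI] : exists2 w, w \in X & w \notin I.
  by apply/subsetPn; apply: contra neIX => XI; rewrite eqEsubset IX.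
have lt x : x \in X -> x \notin I -> #|X| - #|x |: I| < m.
  move=> xX xI; have := subset_leq_card (_ : x |: I \subset X).
  by rewrite subUset sub1set xX IX cardsU1 xI => /(_ isT); move: Im; clear; lia.
have sub x : x \in X -> x |: I \subset X by move=> xX; rewrite subUset sub1set xX.
have big x : 1 < #|x |: I| by apply: leq_trans I2 (subset_leq_card (subsetUr _ _)).
have /card_gt0P[i0 i0I] : 0 < #|I| by apply: ltnW.
have [b bI sbI] := exit_ex cs i0I wI.
have [sbX|sbX] := boolP (s b \in X).
  have [a1 g1] := agree_grow cs ct XT H aI I2 IX ag bI sbI sbX.
  by apply: (IH (s b |: I)); rewrite ?lt ?sub.
have [||z] := @exit_ex _ s (X :\: I) w b cs; rewrite ?inE ?wX ?wI ?bI //.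
case/andP=> zI zX szn.
have szI : s z \in I.
  have [szX|szX] := boolP (s z \in X); first by move: szn; rewrite szX andbT negbK.
  by move: zI; rewrite (arc_exit_uniq aX zX szX (subsetP IX _ bI) sbX) bI.
have [] := @agree_grow s^-1%g t^-1%g X I (s z) (circularV cs) (circularV ct) XT _ _ I2 IX
             (agreeV ag) szI.
- move=> D; rewrite arcbV => aD D2 CD2 DX DCX.
  by have [B] := H D aD D2 CD2 DX DCX; exists B; rewrite // /common_arc !arcbV.
- by rewrite arcbV.
- by rewrite permK.
- by rewrite permK.
rewrite permK arcbV => a1 /agreeV; rewrite !invgK => g1.
by apply: (IH (z |: I)); rewrite ?lt ?sub.
Qed.

(** A common arc with at least three vertices is cut by any common arc crossing it, and one of the
    pieces keeps two vertices. [X] itself may be uncrossed; then a pair of consecutive vertices in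
    it is crossed by some [B], and [B] or its complement lies in [X], or [B] crosses [X] after
    all. *)
Lemma exists_common_pair s t X : circular_order s -> circular_order t ->
  X != setT -> common_arc s t X -> 1 < #|X| ->
  (forall D, arcb s D -> 1 < #|D| -> 1 < #|~: D| -> D != X -> D != ~: X ->
     exists2 B, common_arc s t B & crosses B D) ->
  exists M, [/\ common_arc s t M, #|M| = 2 & M \subset X].
Proof.
move=> cs ct XT cX X2 H.
have /subsetPn[u _ uX] : ~~ (setT \subset X) by rewrite subTset.
suff: forall m (M : {set T}), #|M| < m -> common_arc s t M -> 1 < #|M| -> M \subset X ->
    exists M, [/\ common_arc s t M, #|M| = 2 & M \subset X].
  by move/(_ _ X (ltnSn _) cX X2 (subxx _)).
elim=> // m IH M Mm cM M2 MX.
have [M3|M3] := ltnP 2 #|M|; last first.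
  by exists M; split=> //; apply/eqP; rewrite eqn_leq M3.
have shrink (N : {set T}) : common_arc s t N -> 1 < #|N| -> N \proper M ->
    exists M, [/\ common_arc s t M, #|M| = 2 & M \subset X].
  move=> cN N2 NM; apply: (IH N) => //; last exact: subset_trans (proper_sub NM) MX.
  by apply: leq_trans (proper_card NM) _.
have cross (B : {set T}) : common_arc s t B -> crosses M B ->
    exists M, [/\ common_arc s t M, #|M| = 2 & M \subset X].
  move=> cB cMB; have [c1 c2] := crosses_commonID cs ct cM cB cMB.
  have [x [y [z [w [[xM xB] [yM yB] [zM zB] [wM wB]]]]]] := crosses_ex cMB.
  have [h|h] := ltnP 1 #|M :&: B|.
    apply: (shrink (M :&: B)) => //; rewrite properE subsetIl /=.
    by apply/subsetPn; exists y; rewrite // inE (negPf yB) andbF.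
  apply: (shrink (M :\: B)) => //; first by move: M3 h (cardsID B M); clear; lia.
  rewrite properE subsetDl /=.
  by apply/subsetPn; exists x; rewrite // inE xB.
have uM : u \notin M by apply: contra uX => /(subsetP MX).
have [MeX|neMX] := eqVneq M X; last first.
  have [w wX wM] : exists2 w, w \in X & w \notin M.
    by apply/subsetPn; apply: contra neMX => XI; rewrite eqEsubset MX.
  have [|||||B cB cBM] := H M; rewrite ?neMX //; first by case/andP: cM.
  - have : [set w; u] \subset ~: M.
      by apply/subsetP => v /set2P[]->; rewrite inE.
    move/subset_leq_card; rewrite cards2.
    by rewrite (_ : w != u) //; apply: contraNneq uX => <-.
  - have /card_gt0P[i iM] : 0 < #|M| by apply: ltnW.
    by apply/eqP => ME; move: (iM); rewrite ME inE (subsetP MX).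
  by apply: (cross B); rewrite // crossesC.
have /card_gt0P[i iM] : 0 < #|M| by apply: ltnW.
have [b bM sbM] := exit_ex cs iM uM.
have [x xM xb] := card_gt1_ne b M2.
have /andP[aM _] := cM.
have sxM : s x \in M.
  by apply: contraNT xb => sxM; rewrite (arc_exit_uniq aM xM sxM bM sbM).
have sxx : x != s x.
  by rewrite eq_sym (circular_fix cs (y := u)) //; apply: contraNneq uM => <-.
have [w wM wI] : exists2 w, w \in M & w \notin [set x; s x].
  apply/subsetPn; apply/negP => /subset_leq_card; rewrite cards2 sxx.
  by rewrite leqNgt M3.
have uI : u \notin [set x; s x].
  by apply/negP => /set2P[] ux; move: uM; rewrite ux ?xM ?sxM.
have [|||||B cB cBI] := H [set x; s x].
- apply: (@arcb_exits _ _ _ (s x)) => y; rewrite !inE => /orP[/eqP->|/eqP //].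
  by rewrite eqxx orbT.
- by rewrite cards2 sxx.
- have : [set w; u] \subset ~: [set x; s x].
    by apply/subsetP => v /set2P[]->; rewrite inE.
  move/subset_leq_card; rewrite cards2.
  by rewrite (_ : w != u) //; apply: contraNneq uM => <-.
- by apply: contraNneq wI => ->; rewrite -MeX.
- apply/eqP => /setP/(_ x); rewrite !inE eqxx /=.
  by rewrite -MeX xM.
have sIM : [set x; s x] \subset M by apply/subsetP => v /set2P[]->.
have sub (B' : {set T}) : common_arc s t B' -> crosses B' [set x; s x] -> B' \subset M ->
   exists M, [/\ common_arc s t M, #|M| = 2 & M \subset X].
  move=> cB' /crosses_ex[x1 [x2 [x3 [x4 [[h1 k1] [h2 k2] [h3 k3] [h4 k4]]]]]] sB'.
  apply: (shrink B') => //.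
    have : [set x1; x2] \subset B' by apply/subsetP => v /set2P[]->.
    move/subset_leq_card; rewrite cards2.
    by rewrite (_ : x1 != x2) //; apply: contraNneq k2 => <-.
  by rewrite properE sB'; apply/subsetPn; exists x3; rewrite // (subsetP sIM).
have [BM|/subsetPn[p pB pM]] := boolP (B \subset M); first exact: (sub B).
have [BM|/subsetPn[q qB qM]] := boolP (~: B \subset M).
  by apply: (sub (~: B)); rewrite ?common_arcC ?crossesCl.
have [x1 [x2 [x3 [x4 [[h1 k1] [h2 k2] [h3 k3] [h4 k4]]]]]] := crosses_ex cBI.
apply: (cross B) => //; apply: (@crossesP _ _ _ x1 x3 p q) => //.
- by rewrite (subsetP sIM).
- by rewrite (subsetP sIM).
by move: qB; rewrite inE.
Qed.

(** [t] traverses a two-vertex common arc either along [s] or against it, and [agree_spread] carries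
    this direction over [X]. *)
Lemma agree_up_to_reversal s t X : circular_order s -> circular_order t ->
  X != setT -> common_arc s t X -> 1 < #|X| ->
  (forall D, arcb s D -> 1 < #|D| -> 1 < #|~: D| -> D != X -> D != ~: X ->
     exists2 B, common_arc s t B & crosses B D) ->
  agree s t X \/ agree s t^-1%g X.
Proof.
move=> cs ct XT cX X2 H.
have [M [cM M2 MX]] := exists_common_pair cs ct XT cX X2 H.
have /subsetPn[u _ uX] : ~~ (setT \subset X) by rewrite subTset.
have uM : u \notin M by apply: contra uX => /(subsetP MX).
have /andP[aM tM] := cM; have /andP[aX _] := cX.
have /card_gt0P[i iM] : 0 < #|M| by rewrite M2.
have [b bM sbM] := exit_ex cs iM uM.
have [x xM xb] : exists2 x, x \in M & x != b by apply: card_gt1_ne; rewrite M2.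
have sxM : s x \in M.
  by apply: contraNT xb => sxM; rewrite (arc_exit_uniq aM xM sxM bM sbM).
have fx (r : {perm T}) y : circular_order r -> y \in M -> y != r y.
  by move=> cr yM; rewrite eq_sym (circular_fix cr (y := u)) //; apply: contraNneq uM => <-.
have MxE y : y \in M -> y = x \/ y = s x.
  suff -> : M = [set x; s x] by move/set2P.
  apply/esym/eqP; rewrite eqEcard cards2 (fx s) // M2 andbT.
  by apply/subsetP => v /set2P[]->.
have sx b' : b' \in M -> s b' \in M -> b' = x.
  move=> bM' sbM'; case: (MxE _ bM') => // bsx.
  case: (MxE b bM) => bE; first by rewrite bE eqxx in xb.
  by move: sbM; rewrite bE -bsx sbM'.
have H' : forall D, arcb s D -> 1 < #|D| -> 1 < #|~: D| -> D != X -> D != ~: X ->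
     exists2 B, common_arc s t^-1%g B & crosses B D.
  move=> D d1 d2 d3 d4 d5; have [B] := H D d1 d2 d3 d4 d5.
  by exists B; rewrite // /common_arc arcbV.
have [txM|txM] := boolP (t x \in M).
  left; apply: (agree_spread cs ct XT aX H aM); rewrite ?M2 //.
  move=> y yM /(sx _ yM) ->.
  by case: (MxE _ txM) => // txx; move: (fx t x ct xM); rewrite txx eqxx.
right; apply: (agree_spread cs (circularV ct) XT aX H' aM); rewrite ?M2 //.
move=> y yM /(sx _ yM) ->; apply: (@perm_inj _ t); rewrite permKV.
case: (MxE (t (s x))) => //; last first.
  by move=> txx; move: (fx t _ ct sxM); rewrite txx eqxx.
apply: contraTT (fx s x cs xM) => tsx.
exact/negPn/eqP/(arc_exit_uniq tM xM txM sxM tsx).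
Qed.

(** Only the two steps between the sides remain. [t] must leave a side at the exit of [s], or that
    side would be closed under [t]; and it must land where [s] does, since the other vertices of the
    far side already have their predecessors. *)
Lemma agree_glue s t X x0 y0 : circular_order s -> circular_order t ->
  x0 \in X -> y0 \notin X -> arcb s X -> agree s t X -> agree s t (~: X) -> t = s.
Proof.
move=> cs ct x0X y0X aX agX agY.
have key (Z : {set T}) x y : arcb s Z -> y \in ~: Z -> agree s t Z -> agree s t (~: Z) ->
    x \in Z -> s x \notin Z -> t x = s x.
  rewrite inE => aZ yZ agZ agC xZ sxZ.
  have txZ : t x \notin Z.
    apply/negP => txZ; move: yZ; rewrite (circular_closed ct _ xZ) ?inE // => z zZ.
    have [szZ|szZ] := boolP (s z \in Z); first by rewrite agZ.
    by rewrite (arc_exit_uniq aZ zZ szZ xZ sxZ).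
  pose p := (s^-1)%g (t x); have sp : s p = t x by rewrite permKV.
  have [pZ|pZ] := boolP (p \in Z).
    by rewrite -sp (arc_exit_uniq aZ pZ _ xZ sxZ) ?sp.
  have : t p = s p by apply: agC; rewrite inE ?sp.
  by rewrite sp => /perm_inj pe; move: pZ; rewrite pe xZ.
apply/permP => x; have [xX|xX] := boolP (x \in X); have [sxX|sxX] := boolP (s x \in X).
- exact: agX.
- by apply: (key X x y0); rewrite ?inE.
- by apply: (key (~: X) x x0); rewrite ?arcbC ?setCK ?inE ?negbK.
- by apply: agY; rewrite inE.
Qed.

End Agreement.

(** * Arcs as intervals, and tightness as an exit count *)

Section Arcs.
Variable T : finType.
Implicit Types (s t : {perm T}) (A B C X : {set T}) (x y z : T).

Lemma circular_order_size s x : circular_order s -> fingraph.order s x = #|T|.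
Proof.
move=> cs; rewrite -cardsT -(cs x); apply: eq_card => y.
rewrite cs inE; apply/esym.
have /porbitP[i ->] : y \in porbit s x by rewrite cs inE.
by rewrite permX inE fconnect_iter.
Qed.

Lemma circular_fconnect s x y : circular_order s -> fconnect s x y.
Proof.
move=> cs; have /porbitP[i ->] : y \in porbit s x by rewrite cs inE.
by rewrite permX fconnect_iter.
Qed.

Lemma circular_iter s x : circular_order s -> iter #|T| s x = x.
Proof. by move=> cs; rewrite -(circular_order_size x cs) iter_order //; apply: perm_inj. Qed.

Lemma circular_iterP s x y : circular_order s ->
  exists2 i, i < #|T| & y = iter i s x.
Proof.
move=> cs; exists (findex s x y); last by rewrite iter_findex ?circular_fconnect.
by rewrite -(circular_order_size x cs) findex_max ?circular_fconnect.
Qed.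

Lemma circular_findex s x i : circular_order s -> i < #|T| ->
  findex s x (iter i s x) = i.
Proof. by move=> cs iT; rewrite findex_iter ?circular_order_size. Qed.

(** On the walk from [s z], an earlier exit would be [b] met too soon, and a second entry would
    return to [s z] before a full turn. *)
Lemma arc_iter s A z b : circular_order s -> arcb s A ->
  z \notin A -> s z \in A -> b \in A -> s b \notin A ->
  let m := findex s (s z) b in
  m.+1 < #|T| /\ forall j, j < #|T| -> (iter j s (s z) \in A) = (j <= m).
Proof.
move=> cs aA zA szA bA sbA m.
have [mb mT] : b = iter m s (s z) /\ m < #|T|.
  by rewrite iter_findex -?(circular_order_size (s z) cs) ?findex_max ?circular_fconnect.
have mT' : m.+1 < #|T|.
  rewrite ltn_neqAle mT andbT; apply: contraNneq sbA => mT'.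
  by rewrite mb -iterS mT' circular_iter.
split=> // j jT; have [jm|mj] := leqP j m.
  elim: j jm {jT} => // j IH jm; rewrite iterS.
  have jA := IH (ltnW jm); apply: contraTT (jm) => sjA.
  rewrite -leqNgt -(circular_findex (s z) cs (ltn_trans jm mT)).
  by rewrite (arc_exit_uniq aA jA sjA bA sbA).
apply/negbTE; elim: j mj jT => // j IH; rewrite ltnS leq_eqVlt => /orP[/eqP<- _|mj jT].
  by rewrite iterS -mb.
have jA := IH mj (ltnW jT); rewrite iterS; apply/negP => sjA.
have jz := arc_entry_uniq aA jA sjA zA szA.
have := circular_findex (s z) cs jT; rewrite iterS jz.
by rewrite findex0.
Qed.

Lemma arcb_between s A z b : circular_order s -> arcb s A ->
  z \notin A -> s z \in A -> b \in A -> s b \notin A -> A = arc_between s (s z) b.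
Proof.
move=> cs aA zA szA bA sbA; apply/setP => x; rewrite inE.
have [i iT ->] := circular_iterP (s z) x cs.
by have [_ ->] := arc_iter cs aA zA szA bA sbA; rewrite // circular_findex.
Qed.

Lemma between_exit s a b x : circular_order s ->
  x \in arc_between s a b -> s x \notin arc_between s a b -> x = b.
Proof.
move=> cs; rewrite !inE -ltnNge.
have [i iT ->] := circular_iterP a x cs; have [j jT ->] := circular_iterP a b cs.
rewrite -iterS (circular_findex a cs iT) (circular_findex a cs jT) => ij; have [iT'|iT'] := ltnP i.+1 #|T|.
  by rewrite circular_findex // ltnS => ji; congr (iter _ _ _); lia.
by move=> _; congr (iter _ _ _); lia.
Qed.

Lemma between_entry s a b x : circular_order s ->
  x \notin arc_between s a b -> s x \in arc_between s a b -> s x = a.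
Proof.
move=> cs; rewrite !inE -ltnNge.
have [i iT ->] := circular_iterP a x cs; have [j jT ->] := circular_iterP a b cs.
rewrite -iterS (circular_findex a cs iT) (circular_findex a cs jT) => ij; have [iT'|iT'] := ltnP i.+1 #|T|.
  by rewrite circular_findex // => ji; lia.
by have -> : i.+1 = #|T| by [lia]; rewrite circular_iter.
Qed.

Lemma is_arcP s A : circular_order s -> is_arc s A <-> arcb s A.
Proof.
move=> cs; split=> [[->|[a [b ->]]]|aA].
- rewrite /arcb (_ : exits s set0 = set0) ?cards0 //.
  by apply/setP => x; rewrite !inE.
- by apply: (@arcb_exits _ _ _ b) => x; apply: between_exit.
have [->|/set0Pn[a aA']] := eqVneq A set0; [by left | right].
have [AT|AT] := eqVneq A setT.
  exists a, (iter #|T|.-1 s a); rewrite AT; apply/setP => x; rewrite !inE.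
  have T0 : 0 < #|T| by apply/card_gt0P; exists a.
  have [i iT ->] := circular_iterP a x cs.
  by rewrite !circular_findex //; lia.
have /subsetPn[y _ yA] : ~~ (setT \subset A) by rewrite subTset.
have [z zA szA] := entry_ex cs aA' yA; have [b bA sbA] := exit_ex cs aA' yA.
by exists (s z), b; apply: arcb_between.
Qed.

(** If the arcs start together, [B :\: A] is left only at the exit of [B]; if they end together,
    only just before [A]. If they do neither, it is left at both places. This form of tightness is
    visibly invariant under reversal. *)
Lemma share_endpointP s A B : circular_order s -> arcb s A -> arcb s B ->
  A != set0 -> A \subset B -> B != setT ->
  share_endpoint s A B <-> arcb s (B :\: A).
Proof.
move=> cs aA aB /set0Pn[x xA] AB BT.
have /subsetPn[y _ yB] : ~~ (setT \subset B) by rewrite subTset.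
have yA : y \notin A by apply: contra yB => /(subsetP AB).
have xB := subsetP AB _ xA.
have [zA zAn szA] := entry_ex cs xA yA; have [bA bAi sbA] := exit_ex cs xA yA.
have [zB zBn szB] := entry_ex cs xB yB; have [bB bBi sbB] := exit_ex cs xB yB.
split=> [[a [b [c [d [eA eB]]]]]|aD].
  have Ea : a = s zA by rewrite (@between_entry s a b zA cs) // -eA.
  have Eb : b = bA by rewrite (@between_exit s a b bA cs) // -eA.
  have Ec : c = s zB by rewrite (@between_entry s c d zB cs) // -eB.
  have Ed : d = bB by rewrite (@between_exit s c d bB cs) // -eB.
  (* When the first vertex of one arc is the last of the other, the inclusion makes the two first or
     the two last vertices coincide as well. *)
  move=> h; have {h} [eqz|eqb] : zA = zB \/ bA = bB.
    case/set0Pn: h => v; rewrite !inE Ea Eb Ec Ed => /andP[/orP[] /eqP-> /orP[]/eqP].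
    - by move/perm_inj; left.
    - move=> ee; right; rewrite -ee; apply: (arc_exit_uniq aA) => //.
      by apply: contra sbB => /(subsetP AB); rewrite ee.
    - move=> ee; left; apply: (arc_entry_uniq aA) => //; last by rewrite -ee.
      by apply: contra zBn => /(subsetP AB).
    - by right.
  - apply: (@arcb_exits _ _ _ bB) => v; rewrite !inE => /andP[vA vB] sv.
    apply: (arc_exit_uniq aB) => //; apply: contra zBn => svB.
    move: sv; rewrite svB andbT negbK => svA.
    by rewrite -eqz -(arc_entry_uniq aA vA svA zAn szA).
  - apply: (@arcb_exits _ _ _ zA) => v; rewrite !inE => /andP[vA vB] sv.
    apply: (arc_entry_uniq aA) => //; apply: contraNT vA => svA.
    move: sv; rewrite svA /= => svB.
    by rewrite (arc_exit_uniq aB vB svB bBi sbB) -eqb.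
exists (s zA), bA, (s zB), bB; split; try exact: arcb_between.
have [zBi|zBi] := boolP (zA \in B); last first.
  apply/set0Pn; exists (s zA); rewrite !inE eqxx /=.
  by rewrite (arc_entry_uniq aB zBi (subsetP AB _ szA) zBn szB) eqxx.
have [bBA|bBA] := boolP (bB \in A).
  apply/set0Pn; exists bA; rewrite !inE eqxx orbT /=.
  rewrite (arc_exit_uniq aA bAi sbA bBA) ?eqxx ?orbT //.
  by apply: contra sbB => /(subsetP AB).
have zb : zA = bB.
  apply: (arc_exit_uniq aD); rewrite !inE ?zAn ?zBi ?szA ?bBA ?bBi //=.
  by rewrite (negPf sbB) andbF.
by move: sbB; rewrite -zb (subsetP AB).
Qed.

Variable H : {set {set T}}.

Lemma arc_orderingP s :
  arc_ordering H s <-> circular_order s /\ forall A, A \in H -> arcb s A.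
Proof.
by split=> -[cs h]; split=> // A /h hA; apply/(is_arcP A cs).
Qed.

Lemma tight_arc_orderingP s : set0 \notin H ->
  tight_arc_ordering H s <->
  [/\ circular_order s, forall A, A \in H -> arcb s A
    & forall A B, A \in H -> B \in H -> A \subset B -> B != setT -> arcb s (B :\: A)].
Proof.
move=> H0; split=> [[/arc_orderingP[cs h] ti]|[cs h ti]].
  split=> // A B AH BH AB BT; apply/share_endpointP => //; try exact: h; last apply: ti => //.
    by apply: contraNneq H0 => <-.
  by apply: contraNneq H0 => <-.
split; first exact/arc_orderingP.
by move=> A B AH BH A0 AB BT; apply/share_endpointP; auto.
Qed.

End Arcs.

(** * Reversing one side of a circular order *)

Section Reversal.
Variable T : finType.
Implicit Types (s t : {perm T}) (A B C X : {set T}) (x y z : T).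

Lemma exists_flip s X x0 y0 : circular_order s -> arcb s X ->
  x0 \in X -> y0 \notin X ->
  exists2 t : {perm T}, circular_order t &
  [/\ forall x, x \in X -> s x \in X -> t x = s x,
      forall x, x \notin X -> s x \notin X -> t (s x) = x,
      forall x, x \in X -> s x \notin X -> t x \notin X,
      forall x, x \notin X -> (s^-1)%g x \in X -> t x \in X
    & forall C, C \subset X \/ C \subset ~: X -> arcb s C -> arcb t C].
Proof.
move=> cs aX x0X y0X.
have [d dX sdX] := entry_ex cs x0X y0X; have [b bX sbX] := exit_ex cs x0X y0X.
(* The new order follows [s] in [X], jumps from the exit [b] to [d], the last vertex before [X],
   runs backwards through the complement, and jumps from [s b] to the entry [s d] of [X]. *)
pose f x := if x \in X then if s x \in X then s x else d
            else if (s^-1)%g x \in X then s d else (s^-1)%g x.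
have sV x : s ((s^-1)%g x) = x by rewrite permKV.
have exitE x : x \in X -> s x \notin X -> x = b.
  by move=> xX sx; apply: (arc_exit_uniq aX).
have entryE x : x \notin X -> s x \in X -> x = d.
  by move=> xX sx; apply: (arc_entry_uniq aX).
have entryE' x : x \in X -> (s^-1)%g x \notin X -> (s^-1)%g x = d.
  by move=> xX h; apply: entryE; rewrite ?sV.
have exitE' x : x \notin X -> (s^-1)%g x \in X -> (s^-1)%g x = b.
  by move=> xX h; apply: exitE; rewrite ?sV.
have f_inj : injective f.
  move=> x y; rewrite /f.
  case: (boolP (x \in X)) => xX; case: (boolP (y \in X)) => yX.
  - case: (boolP (s x \in X)) => sx; case: (boolP (s y \in X)) => sy.
    + exact: perm_inj.
    + by move=> E; rewrite E (negPf dX) in sx.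
    + by move=> E; rewrite -E (negPf dX) in sy.
    + by rewrite (exitE x) // (exitE y).
  - case: (boolP (s x \in X)) => sx; case: (boolP ((s^-1)%g y \in X)) => sy E.
    + by move/perm_inj: E dX => <-; rewrite xX.
    + by rewrite -E sx in sy.
    + by move: dX; rewrite E sdX.
    + by move: yX; rewrite -(sV y) -E sdX.
  - case: (boolP (s y \in X)) => sy; case: (boolP ((s^-1)%g x \in X)) => sx E.
    + by move/perm_inj: E dX => ->; rewrite yX.
    + by rewrite E sy in sx.
    + by move: dX; rewrite -E sdX.
    + by move: xX; rewrite -(sV x) E sdX.
  - case: (boolP ((s^-1)%g x \in X)) => sx; case: (boolP ((s^-1)%g y \in X)) => sy E.
    + by rewrite -(sV x) -(sV y) (exitE' x) // (exitE' y).
    + by rewrite -E sdX in sy.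
    + by rewrite E sdX in sx.
    + exact: perm_inj E.
pose t := perm f_inj.
have tE x : t x = f x by rewrite permE.
have t1 x : x \in X -> s x \in X -> t x = s x by move=> xX sx; rewrite tE /f xX sx.
have t2 x : x \notin X -> s x \notin X -> t (s x) = x.
  by move=> xX sx; rewrite tE /f (negPf sx) permK (negPf xX).
have t3 x : x \in X -> s x \notin X -> t x = d.
  by move=> xX sx; rewrite tE /f xX (negPf sx).
have t4 x : x \notin X -> (s^-1)%g x \in X -> t x = s d.
  by move=> xX sx; rewrite tE /f (negPf xX) sx.
exists t; last first.
  split=> //; first by move=> x xX sx; rewrite t3.
    by move=> x xX sx; rewrite t4.
  move=> C [] CX aC; last rewrite -arcbV in aC.
    apply: leq_trans aC; apply: subset_leq_card; apply/subsetP => x.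
    rewrite !exitsE => /andP[xC tx]; rewrite xC /=; apply: contra tx => sx.
    by rewrite t1 // (subsetP CX).
  apply: leq_trans aC; apply: subset_leq_card; apply/subsetP => x.
  rewrite !exitsE => /andP[xC tx]; rewrite xC /=; apply: contra tx => sx.
  have xX : x \notin X by have := subsetP CX _ xC; rewrite inE.
  have sxX : (s^-1)%g x \notin X by have := subsetP CX _ sx; rewrite inE.
  by rewrite -[X in t X]sV t2 // sV.
apply: closed_circular => A x clA xA.
have tA y : (t y \in A) = (y \in A).
  have E : t @: A = A.
    apply/eqP; rewrite eqEcard card_imset; last exact: perm_inj.
    by rewrite leqnn andbT; apply/subsetP => _ /imsetP[z zA ->]; apply: clA.
  by rewrite -[in LHS]E mem_imset //; apply: perm_inj.
(* An arc [Z] along which membership in [A] is constant cannot meet [A] only partly: it would be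
   left both from [A :&: Z] and from [Z :\: A]. *)
have fill (Z : {set T}) y : arcb s Z ->
    (forall z, z \in Z -> s z \in Z -> (s z \in A) = (z \in A)) ->
    y \in Z -> y \in A -> Z \subset A.
  move=> aZ inv yZ yA; apply/subsetP => w wZ; apply: contraT => wA.
  have [||p] := @exit_ex _ s (A :&: Z) y w cs; rewrite ?inE ?yA ?(negPf wA) //.
  case/andP=> pA pZ spn.
  have spZ : s p \notin Z by apply: contra spn => spZ; rewrite spZ inv ?pA.
  have [||q] := @exit_ex _ s (Z :\: A) w y cs; rewrite ?inE ?yA ?wA //.
  case/andP=> qA qZ sqn.
  have [sqZ|sqZ] := boolP (s q \in Z); last first.
    by move: qA; rewrite (arc_exit_uniq aZ qZ sqZ pZ spZ) pA.
  by move: sqn; rewrite inv // qA sqZ.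
have fillX y : y \in X -> y \in A -> X \subset A.
  by apply: fill => // z zX szX; rewrite -t1 ?tA.
have fillC y : y \notin X -> y \in A -> ~: X \subset A.
  move=> yX; apply: (fill _ y); rewrite ?arcbC ?inE // => z; rewrite !inE => zX szX.
  by rewrite -[s z \in A]tA t2.
have bA : b \in A.
  have [xX|xX] := boolP (x \in X); first by rewrite (subsetP (fillX _ xX xA)).
  have sbA : s b \in A by rewrite (subsetP (fillC _ xX xA)) // inE.
  have sdA : s d \in A by rewrite -(t4 (s b)) ?tA // permK.
  by rewrite (subsetP (fillX _ sdX sdA)).
have dA : d \in A by rewrite -(t3 b) ?tA.
apply/setP => y; rewrite inE; have [yX|yX] := boolP (y \in X).
  by rewrite (subsetP (fillX _ bX bA)).
by rewrite (subsetP (fillC _ dX dA)) // inE.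
Qed.

End Reversal.

(** * Index arithmetic excluding an uncrossed arc *)

Section UncrossedArithmetic.
Variables (n : nat) (F : nat -> nat).
Hypothesis F_gt : forall i, i < F i.
Hypothesis F_mono : forall i j, i <= j -> F i <= F j.
Hypothesis F_per : forall i, F (i + n) = F i + n.
Hypothesis F_FF : forall i, F (F i) < i + n.
Hypothesis F_sep : forall i, F i < F i.+1 \/ exists j, F j = i.+1 + n.

(** Meant for an uncrossed arc with indices [a.+1] to [b]: a vertex [v i] with non-neighbors on both
    sides of the end [b] does not have neighbors on both sides of the end [a]. *)
Definition straddling a b :=
  forall i, F i <= b -> F b.+1 <= i + n -> F i <= a.+1 \/ F (a + n) <= i + n.

Lemma F_crossing a b c : a <= b -> F a <= c -> c < F b ->
  exists i, [/\ a <= i, i < b, F i <= c & c < F i.+1].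
Proof.
move=> ab; rewrite -(subnKC ab); elim: (b - a) => [|m IH] Fa; first by rewrite addn0; lia.
rewrite addnS => Fb; have [h|h] := ltnP c (F (a + m)); last by exists (a + m); split=> //; lia.
by have [i [? ? ? ?]] := IH Fa h; exists i; split=> //; lia.
Qed.

(** The jump makes [F] constant from [b.+1] to [a + n]: the straddling condition at [k = F b.+1 - n]
    gives [F (a + n) <= F b.+1]. Then [F_sep] just before [a + n] asks for the value [a + n + n] of
    [F], which is the jumped-over [a + n] one period later. *)
Lemma no_jump a b i : a.+1 < b -> b.+1 < a + n -> straddling a b ->
  F i <= b.+1 -> a + n < F i.+1 -> False.
Proof.
move=> ab ba st Fi Fi1.
have ib : i.+1 <= b.+1 by apply: leq_trans (F_gt i) Fi.
have Fb1 := F_mono ib.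
have Fan : F (a + n).+1 < i.+1 + n.
  by apply: leq_ltn_trans (F_FF i.+1); apply: F_mono.
have Fa1 : F a.+1 <= i by move: Fan; rewrite -addSn F_per; clear; lia.
have [j [aj jb Fj Fj1]] : exists j, [/\ a.+1 <= j, j < b, F j <= b & b < F j.+1].
  by apply: F_crossing; [lia | lia | exact: F_gt].
have low k : a < k -> ~ F k <= a.+1 by have := F_gt k; lia.
have Fbj : F b.+1 <= j + n.
  by have := F_mono Fj1; have := F_FF j.+1; lia.
have Faj : F (a + n) <= j + n by case: (st j Fj Fbj) => // /(low _ aj).
have [k Fbk] : exists k, F b.+1 = k + n.
  by exists (F b.+1 - n); rewrite subnK //; lia.
have Fban := F_mono (ltnW ba).
have kj : k <= j by lia.
have ak : a < k by lia.
have Fak : F (a + n) <= k + n.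
  have Fk : F k <= b by apply: leq_trans (F_mono kj) _.
  by case: (st k Fk) => // [|/(low _ ak)//]; rewrite Fbk.
have [p pE] : exists p, a + n = p.+1 by exists (a + n).-1; lia.
have bp : b.+1 <= p by lia.
have Fp := F_mono bp.
case: (F_sep p); first by rewrite -pE; lia.
case=> y; rewrite -pE => Fy.
have [yi|iy] := leqP y (i + n).
  by have := F_mono yi; rewrite F_per; lia.
have := F_mono iy; rewrite -addSn F_per; lia.
Qed.

(** Let [j] and [i] be last with [F j <= b] and [F i <= a + n]. As [F] jumps over neither side,
    straddling gives [F (a + n) <= j + n] and [F b <= i]. If [v b] reaches across the end [b], the
    side condition yields [b < F a.+1 <= F j <= b]; the other end is symmetric. *)
Lemma no_uncrossed a b : n <= a -> a.+1 < b -> b.+1 < a + n ->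
  straddling a b -> straddling b (a + n) ->
  (b.+1 < F b -> F b <= a + n -> b + n < F (a + n).+1) ->
  ((a + n).+1 < F (a + n) -> F (a + n) <= b + n -> a + n + n < F (b + n).+1) ->
  b.+1 < F b \/ (a + n).+1 < F (a + n) -> False.
Proof.
move=> na ab ba st1 st2 sd1 sd2 conn.
(* [n <= a] lets the search start at [0], because [F 0 < F (F 0) < n]. *)
have [j [aj jb Fj Fj1]] : exists j, [/\ 0 <= j, j < b, F j <= b & b < F j.+1].
  apply: F_crossing => //; have := F_FF 0; have := F_gt (F 0); lia.
have [i [_ ia Fi Fi1]] : exists i, [/\ 0 <= i, i < a + n, F i <= a + n & a + n < F i.+1].
  apply: F_crossing => //; have := F_FF 0; have := F_gt (F 0); lia.
have j1 : F (a + n) <= j + n.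
  case: (st1 j Fj).
  - by have := F_mono Fj1; have := F_FF j.+1; lia.
  - move=> Fja; exfalso.
    have k1 := F_per j; have k2 := F_per j.+1; rewrite addSn in k2.
    by apply: (@no_jump b (a + n) (j + n)) => //; lia.
  - by [].
have i1 : F b <= i.
  case: (st2 i Fi).
  - by have := F_mono Fi1; have := F_FF i.+1; lia.
  - by move=> Fib; exfalso; apply: (@no_jump a b i).
  - by rewrite F_per; lia.
have ja := F_gt (a + n); have ib := F_gt b.
case: conn => h.
  have aj' : a.+1 <= j by lia.
  have Fb : F b <= a + n by have := F_gt i; lia.
  have := F_per a.+1; have := F_mono aj'; have := sd1 h Fb; rewrite addSn; lia.
have bi : b.+1 <= i by lia.
have Fan : F (a + n) <= b + n by lia.
have := F_per b.+1; have := F_mono bi; have := sd2 h Fan; rewrite addSn; lia.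
Qed.

End UncrossedArithmetic.

(* [v] lists the vertices periodically by left endpoint, and [F i] is the first
   index whose left endpoint lies beyond the right endpoint of [v i]. *)
Record arc_model (T : finType) (e : rel T) (v : nat -> T) (F : nat -> nat) : Prop :=
  ArcModel {
    model_eq : forall i j, (v i == v j) = (i == j %[mod #|T|]);
    model_surj : forall x, exists i, v i = x;
    model_gt : forall i, i < F i;
    model_mono : forall i j, i <= j -> F i <= F j;
    model_per : forall i, F (i + #|T|) = F i + #|T|;
    model_adj : forall i j, i < j -> j < i + #|T| ->
      e (v i) (v j) = (j < F i) || (i + #|T| < F j) }.

Lemma two_cliques_bipartite (T : finType) (e : rel T) (X : {set T}) x0 y0 :
  x0 \in X -> y0 \notin X ->
  (forall x y, x \in X -> y \in X -> x != y -> e x y) ->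
  (forall x y, x \notin X -> y \notin X -> x != y -> e x y) ->
  bipartite (complement e).
Proof.
move=> x0X y0X cX cY; exists [set X; ~: X].
have nC : ~: X != X by apply/eqP => /setP/(_ x0); rewrite inE x0X.
have X0 : set0 != X by apply: contraTneq x0X => <-; rewrite inE.
have Y0 : set0 != ~: X by apply: contraNneq y0X => /setP/(_ y0); rewrite !inE => /esym/negbFE.
split.
- apply/and3P; split.
  + rewrite /cover bigcup_setU !big_set1; apply/eqP/setP => x; rewrite !inE.
    by case: (x \in X).
  + apply/trivIsetP => A B /set2P[]-> /set2P[]->; rewrite ?eqxx // => _.
      by rewrite disjoints_subset setCK subxx.
    by rewrite disjoints_subset subxx.
  + by rewrite !inE negb_or X0.
- by rewrite cards2 eq_sym nC.
- move=> A u w /set2P[]->; rewrite ?inE => uX wX; rewrite /complement /= negb_and !negbK;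
    have [//|uw] /= := eqVneq u w; [exact: cX | exact: cY].
Qed.

(** * Neighborhoods in a periodic arc model *)

Section Model.
Variables (T : finType) (e : rel T) (v : nat -> T) (F : nat -> nat).
Hypothesis e_sym : symmetric e.
Hypothesis model : arc_model e v F.
Local Notation n := #|T|.
Local Notation N := (closed_nbhd e).

Let F_gt := model_gt model.
Let F_mono := model_mono model.
Let F_per := model_per model.

Lemma model_n_gt0 : 0 < n.
Proof. by apply/card_gt0P; exists (v 0). Qed.

Lemma model_addn i : v (i + n) = v i.
Proof. by apply/eqP; rewrite (model_eq model) modnDr. Qed.

Lemma model_window a x : exists j, [/\ a <= j, j < a + n & v j = x].
Proof.
have [i <-] := model_surj model x; have n0 := model_n_gt0.
(* Adding [a * n] keeps the residue and prevents the subtraction from truncating. *)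
exists (a + (i + a * n - a) %% n); split; rewrite ?leq_addr ?ltn_add2l ?ltn_pmod //.
apply/eqP; rewrite (model_eq model) modnDmr subnKC ?modnMDl 1?addnC ?modnMDl //.
by apply: leq_trans (leq_pmulr _ n0) (leq_addr _ _).
Qed.

Lemma model_inj a i j : a <= i -> i < a + n -> a <= j -> j < a + n -> v i = v j -> i = j.
Proof.
wlog ij : i j / i <= j.
  by move=> h *; case/orP: (leq_total i j) => ij; [|apply/esym]; apply: h.
move=> ai ia aj ja /eqP; rewrite (model_eq model) eq_sym eqn_mod_dvd //.
have [ji _|h] := leqP j i; first by apply/eqP; rewrite eqn_leq ij.
move/dvdn_leq; rewrite subn_gt0 => /(_ h) h2; exfalso.
by move: h h2 ai ja; clear; lia.
Qed.

Lemma model_neq i j : i < j -> j < i + n -> v i != v j.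
Proof.
move=> ij ji; apply/eqP => /(model_inj (leqnn i) _ (ltnW ij) ji).
by have := model_n_gt0; lia.
Qed.

Lemma mem_nbhd i j : i <= j -> j <= i + n ->
  (v j \in N (v i)) = (j < F i) || (i + n < F j).
Proof.
move=> ij ji; rewrite inE; have n0 := model_n_gt0.
have [E|h] := eqVneq j i; first by rewrite E eqxx F_gt.
have [->|h'] := eqVneq j (i + n).
  by rewrite model_addn eqxx F_per ltn_add2r F_gt orbT.
have ij' : i < j by rewrite ltn_neqAle eq_sym h.
have ji' : j < i + n by rewrite ltn_neqAle h'.
by rewrite eq_sym (negPf (model_neq ij' ji')) (model_adj model).
Qed.

Lemma run_clique a j k : a <= j -> j < k -> k < F a -> k < a + n -> e (v j) (v k).
Proof.
move=> aj jk kF kn; rewrite (model_adj model) //; last by lia.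
by rewrite (leq_trans kF) ?F_mono.
Qed.

(** Otherwise the run from [i] up to [F i] and the run from there on cover the circle, and each run
    is a clique. *)
Lemma model_FF i : 1 < n -> ~ bipartite (complement e) -> F (F i) < i + n.
Proof.
move=> n1 nb; rewrite ltnNge; apply/negP => h; apply: nb.
(* The minimum keeps the second clique nonempty when [v i] reaches all the way around. *)
pose m := minn (F i) (i + n.-1).
have im : i < m by rewrite leq_min F_gt; lia.
have mn : m < i + n by rewrite gtn_min; apply/orP; right; lia.
have mF : m <= F i by rewrite geq_minl.
have Fm : i + n <= F m.
  rewrite /m; have [//|h'] := leqP (F i) (i + n.-1).
  by have := F_gt (i + n.-1); lia.
pose X := [set x | [exists j : 'I_n, (i + j < m) && (v (i + j) == x)]].
have memX j : i <= j -> j < i + n -> (v j \in X) = (j < m).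
  move=> ij jn; rewrite inE; apply/existsP/idP => [[k /andP[km /eqP]]|jm].
    by move/(@model_inj i) <-; rewrite ?leq_addr ?ltn_add2l.
  have lt : j - i < n by lia.
  by exists (Ordinal lt) => /=; rewrite subnKC // jm eqxx.
have wlg (P : T -> T -> Prop) : (forall x y, P x y -> P y x) ->
    (forall j k, i <= j -> j < k -> k < i + n -> P (v j) (v k)) ->
    forall x y, x != y -> P x y.
  move=> Ps Pv x y.
  have [j [ij jn <-]] := model_window i x; have [k [ik kn <-]] := model_window i y.
  by case: (ltngtP j k) => [jk _|kj _|->]; rewrite ?eqxx //; [|apply: Ps]; apply: Pv.
apply: (@two_cliques_bipartite _ e X (v i) (v m)).
- by rewrite memX // -[ltnLHS]addn0 ltn_add2l ltnW.
- by rewrite memX ?ltnn // ltnW.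
- move=> x y xX yX xy; move: x y xy xX yX; apply: wlg.
    by move=> x y h1 *; rewrite e_sym; apply: h1.
  move=> j k ij jk kn; have ik := leq_trans ij (ltnW jk); have jn := ltn_trans jk kn.
  rewrite !memX // => jm km.
  by apply: (@run_clique i); rewrite // (leq_trans km).
- move=> x y xX yX xy; move: x y xy xX yX; apply: wlg.
    by move=> x y h1 *; rewrite e_sym; apply: h1.
  move=> j k ij jk kn; have ik := leq_trans ij (ltnW jk); have jn := ltn_trans jk kn.
  rewrite !memX // -!leqNgt => jm km.
  by apply: (@run_clique m); rewrite ?(leq_trans kn) // leq_add2r ltnW.
Qed.

(** Consecutive vertices with the same forward reach are not twins, so they differ backwards: some
    [v j] reaches exactly up to index [i + n]. *)
Lemma model_sep i : 1 < n -> twin_free e -> F i < F i.+1 \/ exists j, F j = i.+1 + n.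
Proof.
move=> n1 tf; have [|h] := ltnP (F i) (F i.+1); [by left | right].
have Fi : F i.+1 = F i by apply/eqP; rewrite eqn_leq h F_mono.
have Fi1 := F_gt i.+1.
have in1 : i.+1 < i + n by lia.
have := tf _ _ (model_neq (ltnSn i) in1).
have [/existsP[j /eqP]|nj] := boolP [exists j : 'I_(i.+1 + n), F j == i.+1 + n].
  by exists j.
case; apply/setP => x; have [j [ij jn <-]] := model_window i.+1 x.
rewrite !mem_nbhd //; [|lia..].
rewrite Fi; congr (_ || _); rewrite addSn [in RHS]ltn_neqAle.
suff -> : (i + n).+1 != F j by [].
apply: contra nj => /eqP Fj; apply/existsP; exists (Ordinal jn).
by rewrite -Fj.
Qed.

Lemma model_eqS i j : (v i.+1 == v j.+1) = (v i == v j).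
Proof. by rewrite !(model_eq model) -(addn1 i) -(addn1 j) eqn_modDr. Qed.

Lemma exists_model_perm : exists s : {perm T}, forall i, s (v i) = v i.+1.
Proof.
have ex x : exists j, v j == x by have [j <-] := model_surj model x; exists j.
have f_eq i : v (xchoose (ex (v i))).+1 = v i.+1.
  by apply/eqP; rewrite model_eqS; apply: xchooseP (ex (v i)).
have f_inj : injective (fun x => v (xchoose (ex x)).+1).
  move=> x y; have [i <-] := model_surj model x; have [j <-] := model_surj model y.
  by rewrite !f_eq => /eqP; rewrite model_eqS => /eqP.
by exists (perm f_inj) => i; rewrite permE f_eq.
Qed.

Section Order.
Variable s : {perm T}.
Hypothesis sE : forall i, s (v i) = v i.+1.

Lemma model_iter i j : iter j s (v i) = v (i + j).
Proof. by elim: j => [|j IH]; rewrite ?addn0 // iterS IH sE addnS. Qed.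

Lemma model_circular : circular_order s.
Proof.
apply: closed_circular => A x clA; have [i <-] := model_surj model x => xA.
apply/setP => y; rewrite inE; have [j [ij _ <-]] := model_window i y.
by rewrite -(subnKC ij); elim: (j - i) => [|k IH]; rewrite ?addn0 // addnS -sE clA.
Qed.

Lemma nbhd_exit i x : x \in N (v i) -> s x \notin N (v i) -> s x = v (F i).
Proof.
have [j [ij jn <-]] := model_window i x; rewrite sE.
have [//|ne] := eqVneq j.+1 (F i); first by move->.
rewrite !mem_nbhd ?(leq_trans ij) // ?(ltnW jn) // negb_or -!leqNgt.
by have := F_mono (leqnSn j); move: ne; clear; lia.
Qed.

Lemma model_arc x : arcb s (N x).
Proof.
have [i <-] := model_surj model x.
apply: (@arcb_exits _ _ _ ((s^-1)%g (v (F i)))) => y yN syN.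
by rewrite -(nbhd_exit yN syN) permK.
Qed.

(* If [N x <= N y] and [x] follows [y] in the run of [y], then the two arcs end
   together; otherwise they start together. *)
Lemma model_tight x y : N x \subset N y -> N y != setT -> arcb s (N y :\: N x).
Proof.
have cs := model_circular; move=> sub yT.
have /subsetPn[p _] : ~~ (setT \subset N y) by rewrite subTset.
have xy : x \in N y by rewrite (subsetP sub) // inE eqxx.
have yy : y \in N y by rewrite inE eqxx.
have [i iy] := model_surj model y; move: sub xy yy; rewrite -{}iy => {y yT} sub xy yy.
have [j [ij jn jx]] := model_window i x; move: sub xy; rewrite -{}jx => {x} sub.
move=> + pN; rewrite mem_nbhd ?(ltnW jn) // => /orP[jF|iF].
  have [k [ik kn kp]] := model_window i p; move: pN.
  rewrite -kp mem_nbhd ?(ltnW kn) // negb_or -!leqNgt => /andP[Fk kF].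
  have FF : F (F i) <= i + n by apply: leq_trans (F_mono Fk) kF.
  have Fin : F i <= i + n by apply: leq_trans Fk (ltnW kn).
  (* This forces [F j <= F i], so every exit of the difference leads into [N (v j)], which has a
     single entry. *)
  have : v (F i) \notin N (v j).
    apply/negP => /(subsetP sub); rewrite mem_nbhd ?(ltnW (F_gt i)) //.
    by rewrite ltnn ltnNge FF.
  rewrite mem_nbhd ?(ltnW jF) //; last by move: Fin ij; clear; lia.
  rewrite negb_or -!leqNgt => /andP[Fji _].
  have zE z : z \in N (v i) :\: N (v j) -> s z \notin N (v i) :\: N (v j) ->
      z \notin N (v j) /\ s z \in N (v j).
    rewrite inE => /andP[zj zi]; rewrite inE => szn; split=> //.
    have [szi|szi] := boolP (s z \in N (v i)); first by move: szn; rewrite szi andbT negbK.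
    have F0 : F i = (F i).-1.+1 by rewrite prednK // (leq_trans _ jF).
    have zF : z = v (F i).-1 by apply: (@perm_inj _ s); rewrite sE -F0 (nbhd_exit zi).
    case/negP: zj; rewrite zF mem_nbhd.
    - by move: jF (F_mono ij); clear; lia.
    - by move: jF; clear; lia.
    - by move: Fin ij; clear; lia.
  apply: arcb_uniq => z w zD szD wD swD.
  have [zj szj] := zE z zD szD; have [wj swj] := zE w wD swD.
  exact: arc_entry_uniq (model_arc (v j)) zj szj wj swj.
(* Here [v k] is the last vertex before [N (v i)], and its successor already belongs to [N (v j)].
   With this common start, every exit of the difference is an exit of [N (v i)]. *)
have [w0] := entry_ex cs yy pN; have [k [ik kn <-]] := model_window i w0.
rewrite sE => ki ski; have kj : v k \notin N (v j) by apply: contra ki => /(subsetP sub).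
move: (ki) (ski); rewrite !mem_nbhd ?(leq_trans ik) // ?(ltnW kn) // negb_or -!leqNgt.
case/andP=> Fik Fk; rewrite ltnNge (leq_trans Fik (leqnSn _)) /= => Fk1.
have skj : v k.+1 \in N (v j).
  have jk : k < j by rewrite ltnNge; apply/negP => /F_mono jk; move: jk iF Fk; clear; lia.
  rewrite -model_addn mem_nbhd; [|move: ik jn; clear; lia|move: jk; clear; lia].
  by rewrite F_per ltn_add2r (ltn_trans jn Fk1) orbT.
apply: arcb_uniq => z w; rewrite !in_setD => /andP[zj zi] szn /andP[wj wi] swn.
have zE u : u \notin N (v j) -> u \in N (v i) ->
    ~~ ((s u \notin N (v j)) && (s u \in N (v i))) -> s u \notin N (v i).
  move=> uj ui; apply: contra => sui; rewrite sui andbT; apply: contra ki => suj.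
  rewrite (_ : v k = u) //.
  by apply: (arc_entry_uniq (model_arc (v j))) => //; rewrite sE.
by apply: (arc_exit_uniq (model_arc (v i))) => //; apply: zE.
Qed.

Definition window (I : {set T}) a b :=
  [/\ a < b, b < a + n & forall i, a < i -> i <= a + n -> (v i \in I) = (i <= b)].

Lemma windowC I a b : window I a b -> window (~: I) b (a + n).
Proof.
case=> ab ba h; split=> //; first by rewrite ltn_add2r.
move=> i bi ib; rewrite inE; have [ia|ia] := leqP i (a + n).
  by rewrite h ?(ltn_trans ab) // -ltnNge bi.
have an : n <= i by apply: leq_trans (ltnW ia); rewrite leq_addl.
rewrite -(subnK an) model_addn h; [|lia..].
by apply/negbTE; lia.
Qed.

Lemma arc_window I x y : arcb s I -> x \in I -> y \notin I ->
  exists a b, n <= a /\ window I a b.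
Proof.
have cs := model_circular.
move=> aI xI yI; have [z zI szI] := entry_ex cs xI yI.
have [b bI sbI] := exit_ex cs xI yI.
have [a [na _ az]] := model_window n z; move: zI szI; rewrite -az => zI szI.
have [mT mE] := arc_iter cs aI zI szI bI sbI.
set m := findex _ _ _ in mT mE.
exists a, (a.+1 + m); split=> //; split; [lia | lia | move=> i ai ia].
have := mE (i - a.+1); rewrite sE model_iter subnKC // => ->; lia.
Qed.

(** Otherwise the four vertices next to the two ends of the window witness that [N (v i)] crosses
    [I]. *)
Lemma window_straddling I a b : window I a b ->
  (forall x, ~~ crosses (N x) I) -> straddling n F a b.
Proof.
move=> [ab ba W] unc i Fi Fb.
have [|h1] := leqP (F i) a.+1; [by left|].
have [|h2] := leqP (F (a + n)) (i + n); [by right|exfalso].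
have Fi0 := F_gt i; have Fb1 := F_gt b.+1; have Fb' := F_mono (leqnSn b).
have Fa := F_mono (leqnSn (a + n)).
have /negP := unc (v i); apply.
apply: (@crossesP _ _ _ (v a.+1) (v (a + n)) (v b) (v b.+1)).
- have [ia|ia] := leqP i a.+1; first by rewrite mem_nbhd ?h1 //; lia.
  rewrite -model_addn mem_nbhd; [|lia..].
  by rewrite addSn (leq_trans h2 Fa) orbT.
- by rewrite W //; lia.
- have [ai|ai] := leqP a i; first by rewrite mem_nbhd ?h2 ?orbT //; lia.
  by rewrite model_addn mem_nbhd; lia.
- by rewrite W; lia.
- by rewrite mem_nbhd; lia.
- by rewrite W; lia.
- by rewrite mem_nbhd; lia.
- by rewrite W; lia.
Qed.

(** If [v a.+1] did not reach [v b], the set [N (v b)] would cross [I]: it contains [v b] and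
    [v b.+1], but misses [v a.+1] in [I] and [v (F b)] outside. *)
Lemma window_side I a b : window I a b -> (forall i, F (F i) < i + n) ->
  (forall x, ~~ crosses (N x) I) ->
  b.+1 < F b -> F b <= a + n -> b + n < F (a + n).+1.
Proof.
move=> [ab ba W] FF unc h1 h2; rewrite ltnNge; apply/negP => h3.
have Fb := F_gt b; have FFb := FF b; have Fa := F_gt (a + n).+1.
have /negP := unc (v b); apply.
apply: (@crossesP _ _ _ (v b) (v b.+1) (v (a + n).+1) (v (F b))).
- by rewrite mem_nbhd; lia.
- by rewrite W; lia.
- by rewrite mem_nbhd; lia.
- by rewrite W; lia.
- by rewrite mem_nbhd; lia.
- by rewrite -addSn model_addn W; lia.
- by rewrite mem_nbhd; lia.
- by rewrite W; lia.
Qed.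

(** An edge between [I] and its complement passes over an end of the window, and by monotonicity of
    [F] the vertex just before that end reaches the one just after it. Without such edges [I] would
    be closed under adjacency. *)
Lemma window_connected I a b : window I a b -> (forall x y, connect e x y) ->
  b.+1 < F b \/ (a + n).+1 < F (a + n).
Proof.
move=> [ab ba W] co.
have [|h1] := ltnP b.+1 (F b); [by left|].
have [|h2] := ltnP (a + n).+1 (F (a + n)); [by right|exfalso].
have cl : closed e I.
  have key x y : e x y -> x \in I -> y \notin I -> False.
    have [i [ai ia <-]] := model_window a.+1 x; have [j [aj ja <-]] := model_window a.+1 y.
    have ia' : i <= a + n by rewrite -ltnS -addSn.
    have ja' : j <= a + n by rewrite -ltnS -addSn.
    rewrite !W // -ltnNge => + ib bj.
    rewrite (model_adj model) ?(leq_ltn_trans ib bj) //; last by move: ja ai; clear; lia.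
    by move: h1 h2 (F_mono ib) (F_mono ja') ai bj; clear; lia.
  move=> x y exy; apply/idP/idP => h; apply: contraT => h'; exfalso.
    exact: key exy h h'.
  by rewrite e_sym in exy; apply: key exy h h'.
have := closed_connect cl (co (v b) (v b.+1)).
by rewrite !W; lia.
Qed.

End Order.
End Model.

(** * From arcs on the circle to a periodic model *)

Section Realization.
Local Open Scope ring_scope.
Variables (R : realType) (T : finType) (e : rel T) (l r : T -> R).
Hypothesis e_sym : symmetric e.
Hypothesis T_gt0 : (0 < #|T|)%N.
Hypothesis lr_circle : forall v, circle_point (l v) && circle_point (r v).
Hypothesis e_arcs : forall u v, u != v ->
  (e u v <-> exists x, in_circle_arc (l u) (r u) x && in_circle_arc (l v) (r v) x).
Hypothesis lr_proper : forall u v, u != v ->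
  ~ (forall x, in_circle_arc (l u) (r u) x -> in_circle_arc (l v) (r v) x).

Local Notation n := #|T|.

(* The right endpoint lifted to the universal cover, past the left one. *)
Let rt x := if l x <= r x then r x else r x + 1.

Let bounds x : [/\ 0 <= l x, l x < 1, l x <= rt x & rt x < l x + 1].
Proof.
have /andP[/andP[l0 l1] /andP[r0 r1]] := lr_circle x; rewrite /rt.
by case: ifPn => h; split=> //; lra.
Qed.

Let in_arcP x z : in_circle_arc (l x) (r x) z <->
  (0 <= z /\ z < 1) /\ (l x <= z /\ z <= rt x \/ l x <= z + 1 /\ z + 1 <= rt x).
Proof.
have /andP[/andP[l0 l1] /andP[r0 r1]] := lr_circle x.
rewrite /in_circle_arc /circle_point /rt; case: ifPn => h; split.
- by move=> /andP[/andP[z0 z1] /andP[h1 h2]]; split=> //; left.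
- by move=> [[z0 z1] [[h1 h2]|[h1 h2]]]; rewrite z0 z1 /=; apply/andP; split; lra.
- move=> /andP[/andP[z0 z1] /orP[h1|h1]]; split=> //; [left|right]; split; lra.
- by move=> [[z0 z1] [[h1 h2]|[h1 h2]]]; rewrite z0 z1 /=; apply/orP; [left|right]; lra.
Qed.

Let rt_lt x y : x != y -> l x <= l y -> rt x < rt y.
Proof.
move=> xy lxy; rewrite ltNge; apply/negP => h; rewrite eq_sym in xy.
by apply: (lr_proper xy) => z /in_arcP[[z0 z1] hz]; apply/in_arcP; split=> //; lra.
Qed.

(** If this failed, the arc of [y] shifted by one turn would lie within that of [x]. *)
Let rt_lt1 x y : x != y -> rt x < rt y + 1.
Proof.
move=> xy; have [lxy|lxy] := leP (l x) (l y); first by have := rt_lt xy lxy; lra.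
rewrite ltNge; apply/negP => h; rewrite eq_sym in xy.
have [? ? ? ?] := bounds x; have [? ? ? ?] := bounds y.
by apply: (lr_proper xy) => z /in_arcP[[z0 z1] hz]; apply/in_arcP; split=> //; lra.
Qed.

Let l_inj : injective l.
Proof.
move=> x y lxy; apply/eqP; apply: contraT => xy.
have h1 : rt x < rt y by apply: rt_lt => //; rewrite lxy.
have h2 : rt y < rt x by apply: rt_lt; rewrite 1?eq_sym // lxy.
lra.
Qed.

(** Two meeting arcs meet at the left endpoint of one of them: at [l y], or at [l x] seen one turn
    later. *)
Let adj x y : l x < l y -> e x y = (l y <= rt x) || (l x + 1 <= rt y).
Proof.
move=> lxy; have xy : x != y by apply: contraTneq lxy => ->; rewrite ltxx.
have [? ? ? ?] := bounds x; have [? ? ? ?] := bounds y.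
apply/idP/idP.
  case/(e_arcs xy) => z /andP[/in_arcP[[z0 z1] hx] /in_arcP[_ hy]].
  case: hx => -[hx1 hx2]; case: hy => -[hy1 hy2]; apply/orP;
    by first [left; lra | right; lra].
move=> h; apply/(e_arcs xy); case/orP: h => h.
  by exists (l y); apply/andP; split; apply/in_arcP; split=> //; left; split; lra.
exists (l x); apply/andP; split; apply/in_arcP; split=> //; first by left; split; lra.
by right; split; lra.
Qed.

(** The vertices are sorted by left endpoint and repeated periodically. The lifted endpoints [L] and
    [Q] both increase strictly, [Q] because no arc contains another, so the least index with left
    endpoint beyond [Q i] is a monotone function of [i]. *)
Lemma exists_arc_model : exists v F, arc_model e v F.
Proof.
have /card_gt0P[x0 _] := T_gt0.
pose leT := [rel x y : T | l x <= l y].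
pose sq := sort leT (enum T).
have leT_tot : total leT by move=> x y; apply: le_total.
have leT_tr : transitive leT by move=> y x z; apply: le_trans.
have sz : size sq = n by rewrite size_sort -cardE.
have sq_uniq : uniq sq by rewrite sort_uniq enum_uniq.
have mem_sq x : x \in sq by rewrite mem_sort mem_enum.
pose v i := nth x0 sq (i %% n).
have v_lt i j : (i %% n < j %% n)%N -> l (v i) < l (v j).
  move=> ij; rewrite lt_neqAle (inj_eq l_inj) nth_uniq ?sz ?ltn_pmod //.
  rewrite neq_ltn ij /=.
  apply: (sorted_leq_nth leT_tr (fun x => lexx _) x0 (sort_sorted leT_tot _));
    rewrite ?inE ?sz ?ltn_pmod //; exact: ltnW.
pose L i := l (v i) + (i %/ n)%:R.
pose Q i := rt (v i) + (i %/ n)%:R.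
have vn i : v (i + n)%N = v i by rewrite /v modnDr.
have dn i : ((i + n) %/ n = (i %/ n).+1)%N by rewrite divnDr // divnn T_gt0 addn1.
have Ln i : L (i + n)%N = L i + 1 by rewrite /L vn dn -natr1 addrA.
have Qn i : Q (i + n)%N = Q i + 1 by rewrite /Q vn dn -natr1 addrA.
have LQ i : L i <= Q i by have [? ? ? ?] := bounds (v i); rewrite /L /Q; lra.
have QL i : Q i < L i + 1 by have [? ? ? ?] := bounds (v i); rewrite /L /Q; lra.
have div_lt i j : (i < j)%N ->
    (i %/ n = j %/ n)%N /\ (i %% n < j %% n)%N \/ (i %/ n)%:R + 1 <= (j %/ n)%:R :> R.
  move=> ij; have := leq_div2r n (ltnW ij); rewrite leq_eqVlt => /orP[/eqP E|h].
    by left; split=> //; move: ij; rewrite {1}(divn_eq i n) {1}(divn_eq j n) E ltn_add2l.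
  by right; rewrite natr1 ler_nat.
have L_lt i j : (i < j)%N -> L i < L j.
  case/div_lt => [[E h]|h]; rewrite /L; first by rewrite E ltrD2r v_lt.
  by have [? ? ? ?] := bounds (v i); have [? ? ? ?] := bounds (v j); lra.
have L_le i j : (L i <= L j) = (i <= j)%N.
  case: (leqP i j) => [|ji]; last by apply/negbTE; rewrite -ltNge L_lt.
  by rewrite leq_eqVlt => /orP[/eqP->|/L_lt/ltW //]; rewrite lexx.
have Q_lt i j : (i < j)%N -> Q i < Q j.
  case/div_lt => [[E h]|h]; rewrite /Q.
    rewrite E ltrD2r; apply: rt_lt; last by rewrite ltW ?v_lt.
    by apply: contraTneq (v_lt _ _ h) => ->; rewrite ltxx.
  have [->|ne] := eqVneq (v i) (v j); first by lra.
  by have := rt_lt1 ne; lra.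
have ex i : exists j, Q i < L j by exists (i + n)%N; rewrite Ln.
pose F i := ex_minn (ex i).
have FE i j : (j < F i)%N = (L j <= Q i).
  rewrite /F; case: ex_minnP => m Qm mmin; apply/idP/idP => h.
    by rewrite leNgt; apply: contraL h => /mmin; rewrite -leqNgt.
  by rewrite ltnNge -L_le -ltNge; apply: le_lt_trans Qm.
exists v, F; split.
- move=> i j; rewrite /v nth_uniq ?sz ?ltn_pmod //.
- move=> x; exists (index x sq); rewrite /v modn_small ?nth_index //.
  by rewrite -sz index_mem.
- by move=> i; rewrite FE.
- move=> i j ij; rewrite leqNgt; apply/negP; rewrite FE leNgt => /negP; apply.
  apply: (@le_lt_trans _ _ (Q j)).
    by move: ij; rewrite leq_eqVlt => /orP[/eqP->//|/Q_lt/ltW].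
  by rewrite ltNge -FE ltnn.
- move=> i; apply/eqP; rewrite eqn_leq.
  apply/andP; split; rewrite leqNgt; apply/negP.
    by rewrite FE Ln Qn lerD2r -FE ltnn.
  move=> h; have : (F (i + n) < F (i + n))%N; last by rewrite ltnn.
  have ni : (n <= F (i + n))%N.
    apply: leq_trans (_ : i + n <= _)%N; first exact: leq_addl.
    by apply: ltnW; rewrite FE.
  by rewrite FE -{1}(subnK ni) Ln Qn lerD2r -FE ltn_subLR // [X in (_ < X)%N]addnC.
- move=> i j ij ji; rewrite !FE Ln.
  case: (div_lt _ _ ij) => [[E h]|h].
    by rewrite adj ?v_lt // /L /Q E addrAC !lerD2r.
  (* Since [j] lies in the next turn but before [i + n], the left endpoint of [v j] precedes that of
     [v i], and the two disjuncts of [adj] change places. *)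
  have E : (j %/ n = (i %/ n).+1)%N.
    apply/eqP; rewrite eqn_leq -[X in (_ <= X)%N]dn leq_div2r ?(ltnW ji) //=.
    by rewrite -(ler_nat R) -natr1.
  have lt := L_lt _ _ ji; rewrite Ln /L E -natr1 in lt.
  rewrite e_sym adj; last by lra.
  by rewrite /L /Q E -natr1 orbC; congr (_ || _); apply/idP/idP; lra.
Qed.

End Realization.

Lemma pca_arc_model (R : realType) (T : finType) (e : rel T) : symmetric e ->
  0 < #|T| -> proper_circular_arc R e -> exists v F, arc_model e v F.
Proof. by move=> es T0 [l [r [h1 h2 h3]]]; apply: exists_arc_model h1 h2 h3. Qed.

(** * Uniqueness when the complement is not bipartite *)

Section NonBipartite.
Variables (T : finType) (e : rel T).
Hypothesis e_sym : symmetric e.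
Local Notation N := (closed_nbhd e).

(** An uncrossed arc and its complement are two windows meeting the hypotheses of [no_uncrossed]:
    non-bipartiteness bounds [F (F i)], twin-freeness separates successive values, and connectedness
    gives the edge over an end. *)
Lemma arc_crossed v F (s : {perm T}) (I : {set T}) :
  arc_model e v F -> (forall i, s (v i) = v i.+1) ->
  twin_free e -> (forall x y, connect e x y) -> ~ bipartite (complement e) ->
  arcb s I -> 1 < #|I| -> 1 < #|~: I| -> exists x, crosses (N x) I.
Proof.
move=> model sE tf co nb aI I2 CI2.
have [x cx|unc] := pickP [pred x | crosses (N x) I]; first by exists x.
have {}unc x : ~~ crosses (N x) I by apply/negbT/unc.
have uncC x : ~~ crosses (N x) (~: I) by rewrite crossesCr.
exfalso.
have n1 : 1 < #|T| by apply: leq_trans I2 (max_card _).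
have /card_gt0P[x xI] : 0 < #|I| by apply: ltnW.
have /card_gt0P[y] : 0 < #|~: I| by apply: ltnW.
rewrite inE => yI.
have [a [b [na W]]] := arc_window model sE aI xI yI.
have WC := windowC model W.
have FF i : F (F i) < i + #|T| by apply: (model_FF e_sym model).
have [ab ba Wm] := W.
apply: (@no_uncrossed #|T| F (model_gt model) (model_mono model) (model_per model) FF _ a b na).
- by move=> i; apply: (model_sep model).
- have [z zI za] := card_gt1_ne (v a.+1) I2.
  have [j [aj ja jz]] := model_window model a.+1 z; rewrite -jz in zI za.
  have jb : j <= b by rewrite -Wm // -ltnS -addSn.
  apply: leq_trans jb; rewrite ltn_neqAle aj andbT.
  by apply: contraNneq za => ->.
- have [z zI za] := card_gt1_ne (v b.+1) CI2.
  have [j [aj ja jz]] := model_window model b.+1 z; rewrite -jz in zI za.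
  have [_ _ WCm] := WC.
  have jb : j <= a + #|T| by rewrite -WCm // -ltnS -addSn.
  apply: leq_trans jb; rewrite ltn_neqAle aj andbT.
  by apply: contraNneq za => ->.
- exact: (window_straddling model W).
- exact: (window_straddling model WC).
- exact: (window_side model W).
- exact: (window_side model WC).
- exact: (window_connected e_sym model W).
Qed.

Lemma small_agree (s t : {perm T}) (I : {set T}) y : circular_order s ->
  #|I| <= 1 -> y \notin I -> agree s t I.
Proof.
move=> cs /card_le1_eqP I1 yI x xI sxI.
have xy : x != y by apply: contraNneq yI => <-.
have sx : s x = x by apply: I1.
by have := circular_fix cs xy; rewrite sx eqxx.
Qed.

Lemma unique_arc_ordering (s t : {perm T}) : circular_order s -> circular_order t ->
  (forall x, arcb s (N x)) -> (forall x, arcb t (N x)) ->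
  (forall I, arcb s I -> 1 < #|I| -> 1 < #|~: I| -> exists x, crosses (N x) I) ->
  same_up_to_reversal t s.
Proof.
move=> cs ct as_ at_ H.
have [/card_le1_eqP T1|] := leqP #|T| 1.
  by left; apply/permP => x; apply: T1.
case/card_gt1P => p [q [_ _ pq]].
(* With all vertices but one in [X], agreement on the complement is vacuous, so a single orientation
   decides the whole order. *)
pose X := ~: [set p].
have qX : q \in X by rewrite !inE eq_sym.
have pX : p \notin X by rewrite !inE eqxx.
have CX : ~: X = [set p] by rewrite setCK.
have cX : common_arc s t X by rewrite common_arcC /common_arc !arcb1.
have aX : arcb s X by case/andP: cX.
have XT : X != setT by apply: contraNneq pX => ->.
have agC (t' : {perm T}) : agree s t' (~: X).
  by apply: (@small_agree _ _ _ q) => //; rewrite CX ?cards1 // inE eq_sym.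
have fin (t' : {perm T}) : circular_order t' -> agree s t' X -> t' = s.
  by move=> ct' ag; apply: (agree_glue cs ct' qX pX aX ag).
have [X1|X2] := leqP #|X| 1.
  by left; apply: fin => //; apply: small_agree pX.
have [D aD D2 CD2 _ _|ag|ag] := agree_up_to_reversal cs ct XT cX X2.
- by have [x cx] := H D aD D2 CD2; exists (N x); rewrite // /common_arc as_ at_.
- by left; apply: fin.
- right; rewrite -(fin _ (circularV ct) ag) invgK //.
Qed.

End NonBipartite.

(** * Tight orders when the complement is bipartite and connected *)

Section TwoCliques.
Variables (T : finType) (e : rel T).
Hypothesis e_sym : symmetric e.
Local Notation N := (closed_nbhd e).
Local Notation h := (complement e).
Implicit Types (s t : {perm T}) (X I M D Y E : {set T}).

Definition two_cliques X :=
  (forall x y, x \in X -> y \in X -> x != y -> e x y) /\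
  (forall x y, x \notin X -> y \notin X -> x != y -> e x y).

Definition tight_order s :=
  [/\ circular_order s, forall x, arcb s (N x)
    & forall x y, N x \subset N y -> N y != setT -> arcb s (N y :\: N x)].

Lemma nbhd_refl x : x \in N x.
Proof. by rewrite inE eqxx. Qed.

Lemma arc_ordering_nbhdP s : arc_ordering (nbhd_hypergraph e) s <->
  circular_order s /\ forall x, arcb s (N x).
Proof.
split=> [/arc_orderingP[cs H]|[cs H]].
  by split=> // x; apply: H; apply: imset_f.
by apply/arc_orderingP; split=> // A /imsetP[x _ ->].
Qed.

Lemma tight_orderP s : tight_arc_ordering (nbhd_hypergraph e) s <-> tight_order s.
Proof.
have H0 : set0 \notin nbhd_hypergraph e.
  by apply/imsetP => -[x _ /setP/(_ x)]; rewrite nbhd_refl inE.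
split=> [/(tight_arc_orderingP s H0)[cs H1 H2]|[cs H1 H2]].
  by split=> // [x|x y]; [apply: H1|apply: H2]; apply: imset_f.
apply/(tight_arc_orderingP s H0); split=> //.
  by move=> A /imsetP[x _ ->].
by move=> A B /imsetP[x _ ->] /imsetP[y _ ->]; apply: H2.
Qed.

Lemma tight_orderV s : tight_order s -> tight_order s^-1%g.
Proof.
case=> cs H1 H2; split; first exact: circularV.
  by move=> x; rewrite arcbV.
by move=> x y xy yT; rewrite arcbV; apply: H2.
Qed.

Lemma complement_sym : symmetric h.
Proof. by move=> x y; rewrite /complement /= eq_sym e_sym. Qed.

Lemma complementE x y : h x y = (y \notin N x).
Proof. by rewrite /complement /= inE negb_or eq_sym. Qed.

Lemma nbhd_sym x y : (x \in N y) = (y \in N x).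
Proof. by rewrite !inE eq_sym e_sym. Qed.

Lemma two_cliquesC X : two_cliques X -> two_cliques (~: X).
Proof.
by move=> [c1 c2]; split=> x y; rewrite !inE ?negbK; [apply: c2|apply: c1].
Qed.

Lemma clique_in X x y : two_cliques X -> x \in X -> y \in X -> x \in N y.
Proof.
move=> [c1 _] xX yX; rewrite inE; have [//|ne] := eqVneq x y.
by rewrite c1 // eq_sym.
Qed.

Lemma clique_out X x y : two_cliques X -> x \notin X -> y \notin X -> x \in N y.
Proof. by move=> /two_cliquesC c xX yX; apply: (clique_in c); rewrite inE. Qed.

Lemma bipartite_sides : bipartite h ->
  exists X x y, [/\ two_cliques X, x \in X & y \notin X].
Proof.
case=> P [/and3P[/eqP cov triv P0] P2 ind].
have /cards2P[A [B [neAB PE]]] : #|P| == 2 by rewrite P2.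
have AP : A \in P by rewrite PE !inE eqxx.
have BP : B \in P by rewrite PE !inE eqxx orbT.
have /set0Pn[x xA] : A != set0 by apply: contraNneq P0 => <-.
have /set0Pn[y yB] : B != set0 by apply: contraNneq P0 => <-.
have dAB : [disjoint A & B] by move/trivIsetP: triv; apply.
have BC z : z \notin A -> z \in B.
  move=> zA; have : z \in cover P by rewrite cov inE.
  by case/bigcupP => D; rewrite PE => /set2P[]->; rewrite ?(negPf zA).
exists A, x, y; split=> //; last by rewrite (disjointFl dAB).
have cl D u w : D \in P -> u \in D -> w \in D -> u != w -> e u w.
  by move=> DP uD wD uw; have := ind D u w DP uD wD; rewrite /complement /= uw negbK.
split=> u w uA wA; first exact: (cl A).
by apply: (cl B); rewrite ?BC.
Qed.

Hypothesis h_conn : forall x y, connect h x y.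

Lemma connect_step (r : rel T) x y : connect r x y -> x != y -> exists z, r x z.
Proof.
case/connectP => [[|z p]] /= => [_ ->|/andP[xz _] _ _]; first by rewrite eqxx.
by exists z.
Qed.

(** Otherwise [M] together with the vertices having a non-neighbor in [M] would be closed in the
    complement graph, yet it contains [m] and not [w]. *)
Lemma side_link X M m w : two_cliques X -> M \subset X ->
  m \in M -> w \in X -> w \notin M ->
  exists y u u', [/\ y \notin X, u \in M, u \notin N y & [/\ u' \in X, u' \notin M & u' \notin N y]].
Proof.
move=> cX MX mM wX wM.
pose p y := [exists u in M, u \notin N y].
pose q y := [exists u in X, (u \notin M) && (u \notin N y)].
have [y /and3P[yX /exists_inP[u uM uy] /exists_inP[u' u'X /andP[u'M u'y]]]|H]
  := pickP [pred y | [&& y \notin X, p y & q y]].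
  by exists y, u, u'.
exfalso; pose Z := [set z | (z \in M) || p z].
have key x y : h x y -> x \in Z -> y \in Z.
  rewrite complementE => xy; rewrite [x \in Z]inE [y \in Z]inE => /orP[xM|px].
    by apply/orP; right; apply/exists_inP; exists x; rewrite // nbhd_sym.
  have [u uM ux] := exists_inP px.
  have xX : x \notin X.
    by apply: contra ux => xX; apply: (clique_in cX) => //; apply: (subsetP MX).
  have yX : y \in X by apply: contraNT xy => yX; apply: (clique_out cX).
  apply/orP; left; apply: contraFT (H x) => yM; rewrite /= xX px /=.
  by apply/exists_inP; exists y; rewrite // yM.
have cl : closed h Z.
  move=> x y xy; apply/idP/idP; first exact: key.
  by apply: key; rewrite complement_sym.
have := closed_connect cl (h_conn m w); rewrite !inE mM (negPf wM) /= => /esym.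
case/exists_inP => u uM; rewrite (clique_in cX) //; exact: (subsetP MX).
Qed.

(** An arc [M] inside [X], at first a single vertex, is enlarged by the non-neighborhood of a vertex
    [y] from [side_link]. This arc meets [M], stays in [X] and, like [M], avoids [y]. *)
Lemma side_arc s X x0 : circular_order s -> (forall x, arcb s (N x)) ->
  two_cliques X -> x0 \in X -> arcb s X.
Proof.
move=> cs aN cX x0X.
suff: forall m M, #|X| - #|M| < m -> arcb s M -> M \subset X -> M != set0 -> arcb s X.
  move/(_ _ [set x0] (ltnSn _) (arcb1 _ _)); apply; first by rewrite sub1set.
  by apply/set0Pn; exists x0; rewrite inE.
elim=> // m IH M Mm aM MX /set0Pn[u0 u0M].
have [<-//|neMX] := eqVneq M X.
have [w wX wM] : exists2 w, w \in X & w \notin M.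
  by apply/subsetPn; apply: contra neMX => XI; rewrite eqEsubset MX.
have [y [u [u' [yX uM uy [u'X u'M u'y]]]]] := side_link cX MX u0M wX wM.
have yM : y \notin M by apply: contra yX => /(subsetP MX).
have CyX : ~: N y \subset X.
  apply/subsetP => z; rewrite in_setC; apply: contraR => zX.
  exact: (clique_out cX).
have sub : M :|: ~: N y \subset X by rewrite subUset MX.
apply: (IH (M :|: ~: N y)) => //.
- have : #|M| < #|M :|: ~: N y|.
    apply: proper_card; rewrite properE subsetUl; apply/subsetPn; exists u' => //.
    by rewrite in_setU in_setC u'y orbT.
  by move: Mm (subset_leq_card sub); clear; lia.
- have [|||//] := @arcbUI _ s M (~: N y) u y cs aM; first by rewrite arcbC.
  + by rewrite in_setI uM in_setC.
  + by rewrite in_setU in_setC nbhd_refl orbF.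
- by apply/set0Pn; exists u0; rewrite in_setU u0M.
Qed.

(** If [x0] were alone on its side, connectedness of the complement would make it a non-neighbor of
    every other vertex, hence isolated in [e]. *)
Lemma side_gt1 X x0 y0 : irreflexive e -> (forall x y, connect e x y) ->
  two_cliques X -> x0 \in X -> y0 \notin X -> 1 < #|X|.
Proof.
move=> e_irr e_conn cX x0X y0X; rewrite ltnNge; apply/negP => /card_le1_eqP X1.
have ne y : y \notin X -> x0 != y by apply: contraNneq => <-.
have nadj y : y \notin X -> ~~ e y x0.
  move=> yX; have yx : y != x0 by rewrite eq_sym ne.
  have [z] := connect_step (h_conn y x0) yx; rewrite complementE => zy.
  have zX : z \in X by apply: contraNT zy => zX; apply: (clique_out cX).
  by move: zy; rewrite (X1 _ _ zX x0X) inE negb_or => /andP[].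
have [z x0z] := connect_step (e_conn x0 y0) (ne _ y0X).
have [zX|zX] := boolP (z \in X); first by move: x0z; rewrite (X1 _ _ zX x0X) e_irr.
by have := nadj _ zX; rewrite e_sym x0z.
Qed.

Hypothesis tf : twin_free e.

(** A vertex [y'] from [side_link] works if [N y'] meets [I]. Otherwise twin-freeness gives [y]
    separating two vertices of [I]. Either [N y] crosses [I], or all non-neighbors of [y] lie in
    [I]; then [N y'] is contained in [N y], and their difference, a common arc by tightness, crosses
    [I]. *)
Lemma inner_crossed s t X I w : tight_order s -> tight_order t -> two_cliques X ->
  I \subset X -> 1 < #|I| -> w \in X -> w \notin I ->
  exists2 B, common_arc s t B & crosses B I.
Proof.
move=> [cs s1 s2] [ct t1 t2] cX IX /card_gt1P[x1 [x2 [x1I x2I ne]]] wX wI.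
have [y' [u [u' [yX' uI uy [u'X u'I u'y]]]]] := side_link cX IX x1I wX wI.
have cN x : common_arc s t (N x) by rewrite /common_arc s1 t1.
have CyX y z : y \notin X -> z \notin X -> z \in N y.
  by move=> yX zX; apply: (clique_out cX).
have [IC|/subsetPn[z zI]] := boolP (I \subset ~: N y'); last first.
  rewrite in_setC negbK => zN; exists (N y') => //.
  apply: (@crossesP _ _ _ z y' u u') => //; first exact: CyX.
  by apply: contra yX' => /(subsetP IX).
have [y xor] : exists y, (x1 \in N y) != (x2 \in N y).
  have [y hy|E] := pickP [pred y | (x1 \in N y) != (x2 \in N y)]; first by exists y.
  case: (tf ne); apply/setP => y; rewrite ![y \in _]nbhd_sym.
  exact/eqP/negbFE/E.
have [a [b [aI bI ay by_]]] : exists a b, [/\ a \in I, b \in I, a \in N y & b \notin N y].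
  move: xor; case h1: (x1 \in N y); case h2: (x2 \in N y) => // _.
    by exists x1, x2; rewrite h1 h2.
  by exists x2, x1; rewrite h1 h2.
have yX : y \notin X.
  by apply: contra by_ => yX; apply: (clique_in cX) => //; apply: (subsetP IX).
have yI : y \notin I by apply: contra yX => /(subsetP IX).
have [CI|/subsetPn[z]] := boolP (~: N y \subset I); last first.
  rewrite in_setC => zN zI; exists (N y) => //.
  by apply: (@crossesP _ _ _ a y b z) => //; apply: CyX.
have sub : N y' \subset N y.
  by rewrite -setCS; apply: subset_trans CI IC.
have yT : N y != setT by apply: contraNneq by_ => ->.
exists (N y :\: N y').
  by rewrite /common_arc s2 ?t2.
have Iy' z : z \in I -> z \notin N y' by move/(subsetP IC); rewrite in_setC.
apply: (@crossesP _ _ _ a u' b y) => //.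
- by rewrite in_setD ay Iy'.
- rewrite in_setD u'y /=; apply: contraNT u'I => h1.
  by apply: (subsetP CI); rewrite in_setC.
- by rewrite in_setD (negPf by_) andbF.
- by rewrite in_setD CyX.
Qed.

(** When [D] or its complement lies in one side, [inner_crossed] applies. Otherwise both meet both
    sides; a [y] from [side_link] has non-neighbors in [X] inside and outside [D], and [N y]
    contains the whole opposite side. *)
Lemma cobipartite_crossed s t X D : tight_order s -> tight_order t -> two_cliques X ->
  1 < #|D| -> 1 < #|~: D| -> D != X -> D != ~: X ->
  exists2 B, common_arc s t B & crosses B D.
Proof.
move=> ts tt cX D2 CD2 DX DCX; have cCX := two_cliquesC cX.
have step Y E : two_cliques Y -> E \subset Y -> 1 < #|E| -> E != Y ->
    exists2 B, common_arc s t B & crosses B E.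
  move=> cY EY E2 ne; have [w wY wE] : exists2 w, w \in Y & w \notin E.
    by apply/subsetPn; apply: contra ne => YE; rewrite eqEsubset EY.
  exact: (inner_crossed ts tt cY EY E2 wY wE).
have flip E : (exists2 B, common_arc s t B & crosses B (~: E)) ->
    exists2 B, common_arc s t B & crosses B E.
  by case=> B cB; rewrite crossesCr; exists B.
have [sDX|/subsetPn[p pD pX]] := boolP (D \subset X); first exact: (step X).
have [sDX|/subsetPn[q qD]] := boolP (D \subset ~: X); first exact: (step (~: X)).
rewrite in_setC negbK => qX.
have [sDX|/subsetPn[r]] := boolP (~: D \subset X).
  apply/flip/(step X) => //; apply: contra DCX => /eqP <-; by rewrite setCK.
rewrite in_setC => rD rX.
have [sDX|/subsetPn[w]] := boolP (~: D \subset ~: X).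
  apply/flip/(step (~: X)) => //; apply: contra DX => /eqP/setC_inj ->; exact: eqxx.
rewrite !in_setC negbK => wD wX.
have qM : q \in D :&: X by rewrite inE qD.
have wM : w \notin D :&: X by rewrite inE (negPf wD).
have [y [u [u' [yX uM uy [u'X u'M u'y]]]]] := side_link cX (subsetIr D X) qM wX wM.
have uD : u \in D by move: uM; rewrite inE => /andP[].
have u'D : u' \notin D by move: u'M; rewrite inE u'X andbT.
exists (N y); first by case: ts tt => [? s1 _] [? t1 _]; rewrite /common_arc s1 t1.
by apply: (@crossesP _ _ _ p r u u') => //; apply: (clique_out cX).
Qed.

Lemma no_two_cycle s x y : circular_order s -> y != x -> y != s x -> s (s x) != x.
Proof.
move=> cs yx ysx; apply/eqP => ssx.
have : [set x; s x] = setT.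
  apply: (@circular_closed _ s _ x cs); last by rewrite !inE eqxx.
  by move=> z /set2P[]->; rewrite !inE ?ssx eqxx ?orbT.
by move/setP/(_ y); rewrite !inE (negPf yx) (negPf ysx).
Qed.

Lemma arc_inner_step s X y : circular_order s -> arcb s X -> 1 < #|X| -> y \notin X ->
  exists2 x, x \in X & s x \in X.
Proof.
move=> cs aX X2 yX; have /card_gt0P[i iX] : 0 < #|X| by apply: ltnW.
have [b bX sbX] := exit_ex cs iX yX; have [x xX xb] := card_gt1_ne b X2.
exists x => //; apply: contraNT xb => sxX.
exact/eqP/(arc_exit_uniq aX xX sxX bX sbX).
Qed.

(** The second order reverses the complement of [X]. It stays tight because non-neighborhoods, and
    hence differences of nested neighborhoods, lie within one side. Any tight order agrees with [s]
    up to reversal on each side; the relative orientation of the sides selects [s] or [t]. *)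
Lemma two_tight_orders s X x0 y0 : irreflexive e -> (forall x y, connect e x y) ->
  two_cliques X -> x0 \in X -> y0 \notin X -> tight_order s ->
  exactly_two_up_to_reversal tight_order.
Proof.
move=> e_irr e_conn cX x0X y0X ts; have [cs s1 s2] := ts.
have cCX := two_cliquesC cX.
have aX : arcb s X by apply: side_arc cX x0X.
have aCX : arcb s (~: X) by rewrite arcbC.
have X2 : 1 < #|X| by apply: side_gt1 cX x0X y0X.
have CX2 : 1 < #|~: X| by apply: (@side_gt1 (~: X) y0 x0); rewrite ?inE ?negbK.
have XT : X != setT by apply: contraNneq y0X => ->.
have CXT : ~: X != setT.
  by apply: contraTneq x0X => /setP/(_ x0); rewrite !inE.
have [t ct [t1 t2 t3 t4 t5]] := exists_flip cs aX x0X y0X.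
have side x : ~: N x \subset X \/ ~: N x \subset ~: X.
  have [xX|xX] := boolP (x \in X); [right|left]; apply/subsetP => z; rewrite !in_setC.
    by apply: contra => zX; apply: (clique_in cX).
  by apply: contraR => zX; apply: (clique_out cX).
have tt : tight_order t.
  split=> //; first by move=> x; rewrite -arcbC; apply: t5 => //; rewrite arcbC.
  move=> x y xy yT; apply: t5; last exact: s2.
  have sub : N y :\: N x \subset ~: N x by rewrite setDE subsetIr.
  by case: (side x) => h; [left|right]; apply: subset_trans sub h.
have [x xX sxX] := arc_inner_step cs aX X2 y0X.
have [y] : exists2 y, y \in ~: X & s y \in ~: X.
  by apply: (arc_inner_step (y := x0) cs aCX CX2); rewrite inE negbK.
rewrite !in_setC => yX syX.
exists s, t; split=> //.
  (* Equality of [s] and [t] would make a step of [s] outside [X] a two-cycle, and equality up to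
     inversion would do so for a step inside [X]. *)
  case=> E.
    have := t2 y yX syX; rewrite -E.
    apply/eqP/(@no_two_cycle _ _ x0) => //; first by apply: contraNneq yX => <-.
    by apply: contraNneq syX => <-.
  have : s (t x) = x by rewrite E permK.
  rewrite t1 //.
  apply/eqP/(@no_two_cycle _ _ y0) => //; first by apply: contraNneq y0X => ->.
  by apply: contraNneq y0X => ->.
have main t' : tight_order t' -> agree s t' X -> t' = s \/ t' = t.
  move=> tt' ag; have [ct' t'1 _] := tt'.
  have cCX' : common_arc s t' (~: X).
    by rewrite /common_arc aCX arcbC (side_arc ct' t'1 cX x0X).
  have [|agC|agC] := agree_up_to_reversal cs ct' CXT cCX' CX2.
  - by move=> D aD D2 CD2 n1 n2; apply: (cobipartite_crossed (X := ~: X)).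
  - by left; apply: (agree_glue cs ct' x0X y0X aX ag agC).
  right; apply: (agree_glue ct ct' x0X y0X) => //.
  - by apply: t5 => //; left.
  - move=> z zX tzX; have [szX|szX] := boolP (s z \in X).
      by rewrite t1 // ag.
    by have := t3 z zX szX; rewrite tzX.
  - move=> z; rewrite !in_setC => zX tzX.
    have [pX|pX] := boolP ((s^-1)%g z \in X).
      by have := t4 z zX pX; rewrite (negPf tzX).
    have zE : s ((s^-1)%g z) = z by rewrite permKV.
    have := agC ((s^-1)%g z); rewrite zE !in_setC => /(_ pX zX) E.
    by rewrite -{1}E permKV -{2}zE t2 ?zE.
move=> t' tt'; have [ct' t'1 _] := tt'.
have cX' : common_arc s t' X by rewrite /common_arc aX (side_arc ct' t'1 cX x0X).
have [D aD D2 CD2 n1 n2|ag|ag] := agree_up_to_reversal cs ct' XT cX' X2.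
- exact: (cobipartite_crossed (X := X)).
- by case: (main _ tt' ag) => ->; [left|right]; left.
- by case: (main _ (tight_orderV tt') ag) => <-; [left|right]; right; rewrite invgK.
Qed.

End TwoCliques.

Theorem theorem3p7 (R : realType) (T : finType) (e : rel T)
    (e_sym : symmetric e) (e_irr : irreflexive e)
    (e_twin_free : twin_free e) (e_connected : graph_connected e)
    (e_pca : proper_circular_arc R e) :
  (~ bipartite (complement e) ->
     unique_up_to_reversal (arc_ordering (nbhd_hypergraph e)))
  /\
  (bipartite (complement e) -> graph_connected (complement e) ->
     exactly_two_up_to_reversal (tight_arc_ordering (nbhd_hypergraph e))).
Proof.
have [T0 e_conn] := e_connected.
have [v [F model]] := pca_arc_model e_sym T0 e_pca.
have [s sE] := exists_model_perm model.
have cs := model_circular model sE; have aN := model_arc model sE.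
split=> [nb|bip [_ h_conn]].
  exists s; split; first exact/arc_ordering_nbhdP.
  move=> t /arc_ordering_nbhdP[ct tN]; apply: (unique_arc_ordering cs ct aN tN) => I aI I2 CI2.
  exact: (arc_crossed e_sym model sE).
have [X [x0 [y0 [cX x0X y0X]]]] := bipartite_sides bip.
have ts : tight_order e s by split=> // x y; apply: (model_tight model sE).
have [s1 [s2 [t1 t2 ne all]]] :=
  two_tight_orders e_sym h_conn e_twin_free e_irr e_conn cX x0X y0X ts.
exists s1, s2; split=> //; try exact/tight_orderP.
by move=> t /tight_orderP; apply: all.
Qed.
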